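(* Let $\mathscr{D}$ be a $\Bbbk$-linear triangulated category for a field $\Bbbk$. Let $\sigma=(\tau,Z)$ be a pre-stability condition on $\mathscr{D}$. Let $E\in\mathscr{D}$ be an exceptional object which is $\sigma$-stable of phase $1$, let $$\mathscr{D}=\langle\mathscr{B},E\rangle\quad\text{and}\quad\mathscr{D}=\langle E,\mathscr{C}\rangle$$ be the corresponding semiorthogonal decompositions, and let $\beta\colon\mathscr{B}\to\mathscr{D}$ and $\gamma\colon\mathscr{C}\to\mathscr{D}$ be the inclusion functors, with left adjoint $\beta^*$ of $\beta$ and right adjoint $\gamma^!$ of $\gamma$. Then $\tau$ left projects to a bounded t-structure $\beta^*\tau$ on $\mathscr{B}$ and right projects to a bounded t-structure $\gamma^!\tau$ on $\mathscr{C}$; these are noetherian (respectively artinian) if $\tau$ is noetherian (respectively artinian).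
   Context: Write $\mathrm{RHom}(D,D')=\bigoplus_n\mathrm{Hom}(D,D'[n])[-n]$. An object $E$ is exceptional if $\mathrm{RHom}(E,D)$ and $\mathrm{RHom}(D,E)$ have finite total dimension over $\Bbbk$ for all $D\in\mathscr{D}$ and $\Bbbk\to\mathrm{RHom}(E,E)$ is an isomorphism. The corresponding semiorthogonal decompositions have $\mathscr{B}=\{D:\mathrm{RHom}(E,D)=0\}$ and $\mathscr{C}=\{D:\mathrm{RHom}(D,E)=0\}$, and $E$ in them denotes the triangulated subcategory generated by $E$. (Convention: $\mathscr{D}=\langle\mathscr{D}_1,\mathscr{D}_2\rangle$ means $\mathrm{RHom}(\mathscr{D}_2,\mathscr{D}_1)=0$.) A t-structure $\tau=({}^{\tau}\mathscr{D}^{\le0},{}^{\tau}\mathscr{D}^{\ge0})$ has heart ${}^{\tau}\mathscr{D}^{\heartsuit}={}^{\tau}\mathscr{D}^{\le0}\cap{}^{\tau}\mathscr{D}^{\ge0}$; it is noetherian/artinian if the heart is a noetherian/artinian abelian category (ascending/descending chains of subobjects of any object stabilize), and bounded if each object lies in ${}^{\tau}\mathscr{D}^{\ge 0}[-a]\cap{}^{\tau}\mathscr{D}^{\le 0}[-b]$ for some $a,b$. Fix a homomorphism $v\colon\mathrm{K}_0(\mathscr{D})\to\Lambda$ to a finite rank free abelian group. A pre-stability condition (with respect to $v$) is a pair $\sigma=(\tau,Z)$ of a bounded t-structure $\tau$ on $\mathscr{D}$ and a homomorphism $Z\colon\Lambda\to\mathbf{C}$ such that for all $0\ne A\in{}^{\tau}\mathscr{D}^{\heartsuit}$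 one has $Z(v(A))\in\mathbf{R}_{>0}\cdot e^{i\pi\phi}$ for a (unique) $\phi=\phi(A)\in(0,1]$, called the phase, and every nonzero object of the heart has a Harder–Narasimhan filtration with semistable factors. A nonzero object $A$ of the heart is $\sigma$-semistable (resp. $\sigma$-stable) if $\phi(A')\le\phi(A)$ (resp. $\phi(A')<\phi(A)$) for all proper nonzero subobjects $A'\subset A$ in the heart; shifts $A[n]$ are (semi)stable of phase $\phi(A)+n$. $\tau$ right projects to a t-structure on $\mathscr{C}$ if the pair of essential images $\gamma^!\tau=(\gamma^!({}^{\tau}\mathscr{D}^{\le0}),\gamma^!({}^{\tau}\mathscr{D}^{\ge0}))$ is a t-structure on $\mathscr{C}$; $\tau$ left projects to a t-structure on $\mathscr{B}$ if $\beta^*\tau=(\beta^*({}^{\tau}\mathscr{D}^{\le0}),\beta^*({}^{\tau}\mathscr{D}^{\ge0}))$ is a t-structure on $\mathscr{B}$. *)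

(* Defs.v *)
From HB Require Import structures.
From mathcomp Require Import all_boot all_order all_algebra.
From mathcomp Require Import generic_quotient ring_quotient.
From mathcomp Require Import boolp reals trigo.
From mathcomp Require Import complex freeg.

Set Implicit Arguments.
Unset Strict Implicit.
Unset Printing Implicit Defensive.

Import Order.TTheory GRing.Theory Num.Theory.
Local Open Scope ring_scope.
Local Open Scope complex_scope.

Reserved Notation "g \oc f" (at level 40, left associativity).

Record linCat (k : fieldType) := LinCat {
  ob :> Type;
  hom : ob -> ob -> lmodType k;
  idm : forall X, hom X X;
  cmp : forall X Y Z, hom Y Z -> hom X Y -> hom X Z;
  cmpA : forall X Y Z T (h : hom Z T) (g : hom Y Z) (f : hom X Y),
    cmp h (cmp g f) = cmp (cmp h g) f;
  cmp1m : forall X Y (f : hom X Y), cmp (idm Y) f = f;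
  cmpm1 : forall X Y (f : hom X Y), cmp f (idm X) = f;
  cmp_linl : forall X Y Z (f : hom X Y), linear (fun g : hom Y Z => cmp g f);
  cmp_linr : forall X Y Z (g : hom Y Z), linear (fun f : hom X Y => cmp g f)
}.

Arguments hom {k l} X Y : rename.
Arguments idm {k l} X : rename.
Arguments cmp {k l X Y Z} g f : rename.
Notation "g \oc f" := (cmp g f) : ring_scope.

Definition is_iso k (C : linCat k) (X Y : C) (f : hom X Y) :=
  exists g : hom Y X, g \oc f = idm X /\ f \oc g = idm Y.

Definition isom k (C : linCat k) (X Y : C) := exists f : hom X Y, is_iso f.

Definition is_zero k (C : linCat k) (X : C) :=
  forall Y : C, (forall f : hom X Y, f = 0) /\ (forall f : hom Y X, f = 0).

Definition is_biprod k (C : linCat k) (X Y S : C) :=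
  exists (i1 : hom X S) (i2 : hom Y S) (p1 : hom S X) (p2 : hom S Y),
    [/\ p1 \oc i1 = idm X, p2 \oc i2 = idm Y, p1 \oc i2 = 0, p2 \oc i1 = 0
      & i1 \oc p1 + i2 \oc p2 = idm S].

Definition mono k (C : linCat k) (X Y : C) (f : hom X Y) :=
  forall (W : C) (g h : hom W X), f \oc g = f \oc h -> g = h.

Definition is_coker k (C : linCat k) (X Y Q : C) (f : hom X Y) (q : hom Y Q) :=
  q \oc f = 0 /\
  forall (W : C) (g : hom Y W), g \oc f = 0 ->
    exists! u : hom Q W, g = u \oc q.

Definition sub_le k (C : linCat k) (A X Y : C) (f : hom X A) (g : hom Y A) :=
  exists u : hom X Y, f = g \oc u.

Definition sub_eq k (C : linCat k) (A X Y : C) (f : hom X A) (g : hom Y A) :=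
  sub_le f g /\ sub_le g f.

Definition noetherian k (C : linCat k) :=
  forall (A : C) (F : nat -> C) (i : forall n, hom (F n) A),
    (forall n, mono (i n)) -> (forall n, sub_le (i n) (i n.+1)) ->
    exists N, forall n, (N <= n)%N -> sub_eq (i n) (i N).

Definition artinian k (C : linCat k) :=
  forall (A : C) (F : nat -> C) (i : forall n, hom (F n) A),
    (forall n, mono (i n)) -> (forall n, sub_le (i n.+1) (i n)) ->
    exists N, forall n, (N <= n)%N -> sub_eq (i n) (i N).

Record functor k (C D : linCat k) := Functor {
  fob :> C -> D;
  fmap : forall X Y : C, hom X Y -> hom (fob X) (fob Y);
  fmap_id : forall X : C, fmap (idm X) = idm (fob X);
  fmap_cmp : forall (X Y Z : C) (g : hom Y Z) (f : hom X Y),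
    fmap (g \oc f) = fmap g \oc fmap f
}.

(* [F] is left adjoint to [G]. *)
Definition adjoint k (C D : linCat k) (F : functor C D) (G : functor D C) :=
  exists phi : forall (X : C) (Y : D), hom (F X) Y -> hom X (G Y),
    (forall X Y, bijective (phi X Y)) /\
    (forall (X X' : C) (Y Y' : D) (a : hom X' X) (b : hom Y Y')
        (f : hom (F X) Y),
      phi X' Y' (b \oc f \oc fmap F a) = fmap G b \oc phi X Y f \oc a).

Definition ess_image k (C D : linCat k) (F : functor C D) (S : C -> Prop) :
    D -> Prop :=
  fun Y => exists X : C, S X /\ isom (F X) Y.

Definition fullsub k (C : linCat k) (P : C -> Prop) : linCat k :=
  @LinCat k {X : C | P X}
    (fun X Y => hom (sval X) (sval Y))
    (fun X => idm (sval X))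
    (fun X Y Z g f => g \oc f)
    (fun X Y Z T h g f => cmpA h g f)
    (fun X Y f => cmp1m f)
    (fun X Y f => cmpm1 f)
    (fun X Y Z f => @cmp_linl k C _ _ _ f)
    (fun X Y Z g => @cmp_linr k C _ _ _ g).

Definition incl k (C : linCat k) (P : C -> Prop) : functor (fullsub P) C :=
  @Functor k (fullsub P) C (fun X => sval X) (fun X Y f => f)
    (fun X => erefl) (fun X Y Z g f => erefl).

(* The shift is a linear autoequivalence, given as a fully faithful functor
   together with a chosen preimage [unsh X] of each object up to isomorphism.
   [dist f g h] says that X -f-> Y -g-> Z -h-> X[1] is distinguished. *)
Record triCat (k : fieldType) := TriCat {
  tcat :> linCat k;
  tc_zero : exists Z : tcat, is_zero Z;
  tc_biprod : forall X Y : tcat, exists S, is_biprod X Y S;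
  sh : tcat -> tcat;
  shm : forall X Y : tcat, hom X Y -> hom (sh X) (sh Y);
  shm_lin : forall X Y : tcat, linear (@shm X Y);
  shm_id : forall X, shm (idm X) = idm (sh X);
  shm_cmp : forall (X Y Z : tcat) (g : hom Y Z) (f : hom X Y),
    shm (g \oc f) = shm g \oc shm f;
  shm_bij : forall X Y : tcat, bijective (@shm X Y);
  unsh : tcat -> tcat;
  unshK : forall X, isom (sh (unsh X)) X;
  dist : forall X Y Z : tcat, hom X Y -> hom Y Z -> hom Z (sh X) -> Prop;
  TR1_id : forall X Z : tcat, is_zero Z ->
    dist (idm X) (0 : hom X Z) (0 : hom Z (sh X));
  TR1_cone : forall (X Y : tcat) (f : hom X Y),
    exists (Z : tcat) (g : hom Y Z) (h : hom Z (sh X)), dist f g h;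
  TR1_iso : forall (X Y Z X' Y' Z' : tcat)
    (f : hom X Y) (g : hom Y Z) (h : hom Z (sh X))
    (f' : hom X' Y') (g' : hom Y' Z') (h' : hom Z' (sh X'))
    (a : hom X X') (b : hom Y Y') (c : hom Z Z'),
    is_iso a -> is_iso b -> is_iso c ->
    b \oc f = f' \oc a -> c \oc g = g' \oc b -> shm a \oc h = h' \oc c ->
    dist f g h -> dist f' g' h';
  TR2 : forall (X Y Z : tcat)
    (f : hom X Y) (g : hom Y Z) (h : hom Z (sh X)),
    dist f g h <-> dist g h (- shm f);
  TR3 : forall (X Y Z X' Y' Z' : tcat)
    (f : hom X Y) (g : hom Y Z) (h : hom Z (sh X))
    (f' : hom X' Y') (g' : hom Y' Z') (h' : hom Z' (sh X'))
    (a : hom X X') (b : hom Y Y'),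
    dist f g h -> dist f' g' h' -> b \oc f = f' \oc a ->
    exists c : hom Z Z', c \oc g = g' \oc b /\ shm a \oc h = h' \oc c;
  TR4 : forall (X Y Z Q1 Q2 Q3 : tcat) (f : hom X Y) (g : hom Y Z)
    (p1 : hom Y Q1) (d1 : hom Q1 (sh X))
    (p2 : hom Z Q2) (d2 : hom Q2 (sh X))
    (p3 : hom Z Q3) (d3 : hom Q3 (sh Y)),
    dist f p1 d1 -> dist (g \oc f) p2 d2 -> dist g p3 d3 ->
    exists (a : hom Q1 Q2) (b : hom Q2 Q3),
      [/\ dist a b (shm p1 \oc d3),
          a \oc p1 = p2 \oc g, d2 \oc a = d1,
          b \oc p2 = p3 & d3 \oc b = shm f \oc d2]
}.

Arguments sh {k t} X : rename.
Arguments shm {k t X Y} f : rename.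
Arguments unsh {k t} X : rename.
Arguments dist {k t X Y Z} f g h : rename.

Definition shn k (D : triCat k) (n : int) (X : D) : D :=
  match n with
  | Posz m => iter m sh X
  | Negz m => iter m.+1 unsh X
  end.

(* The degree-[n] component of the graded vector space RHom(X, Y). *)
Definition RHom k (D : triCat k) (X Y : D) (n : int) : lmodType k :=
  hom X (shn n Y).

Definition RHom_zero k (D : triCat k) (X Y : D) :=
  forall n (f : RHom X Y n), f = 0.

Definition fin_dim k (V : lmodType k) :=
  exists s : seq V, forall x : V,
    exists c : nat -> k, x = \sum_(i < size s) c i *: s`_i.

Definition fin_total_dim k (V : int -> lmodType k) :=
  (forall n, fin_dim (V n)) /\
  exists N : nat, forall n : int, (N < `|n|)%N -> forall x : V n, x = 0.

(* The base field, in degree 0, maps isomorphically onto RHom(E, E). *)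
Definition RHom_unit_iso k (D : triCat k) (E : D) :=
  bijective (fun a : k => a *: idm E : RHom E E 0) /\
  forall n : int, n != 0 -> forall f : RHom E E n, f = 0.

Definition exceptional k (D : triCat k) (E : D) :=
  [/\ forall X : D, fin_total_dim (RHom E X),
      forall X : D, fin_total_dim (RHom X E)
    & RHom_unit_iso E].

(* Strictly full triangulated subcategories; [ts_zero] for nonempty [P] and
   [ts_biprod] follow from the other clauses. *)
Record triSub k (D : triCat k) (P : D -> Prop) : Prop := TriSub {
  ts_zero : exists Z : D, is_zero Z /\ P Z;
  ts_iso : forall X Y : D, isom X Y -> P X -> P Y;
  ts_biprod : forall X Y S : D, is_biprod X Y S -> P X -> P Y -> P S;
  ts_sh : forall X : D, P X -> P (sh X);
  ts_unsh : forall X : D, P X -> P (unsh X);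
  ts_cone : forall (X Y Z : D) (f : hom X Y) (g : hom Y Z) (h : hom Z (sh X)),
    dist f g h -> P X -> P Y -> P Z
}.

Definition generated k (D : triCat k) (E : D) : D -> Prop :=
  fun X => forall P : D -> Prop, triSub P -> P E -> P X.

Lemma cmp0m k (C : linCat k) (X Y Z : C) (f : hom X Y) :
  (0 : hom Y Z) \oc f = 0.
Proof.
have /(_ (-1) 0 0) := @cmp_linl _ _ X Y Z f.
by rewrite !scaler0 !addr0 scaleN1r addNr.
Qed.

Lemma cmpm0 k (C : linCat k) (X Y Z : C) (f : hom Y Z) :
  f \oc (0 : hom X Y) = 0.
Proof.
have /(_ (-1) 0 0) := @cmp_linr _ _ X Y Z f.
by rewrite !scaler0 !addr0 scaleN1r addNr.
Qed.

Lemma cmpmN k (C : linCat k) (X Y Z : C) (f : hom Y Z) (g : hom X Y) :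
  f \oc (- g) = - (f \oc g).
Proof.
have /(_ (-1) g 0) := @cmp_linr _ _ X Y Z f.
by rewrite cmpm0 !addr0 !scaleN1r.
Qed.

Lemma cmpNm k (C : linCat k) (X Y Z : C) (f : hom Y Z) (g : hom X Y) :
  (- f) \oc g = - (f \oc g).
Proof.
have /(_ (-1) f 0) := @cmp_linl _ _ X Y Z g.
by rewrite cmp0m !addr0 !scaleN1r.
Qed.

Lemma is_zero_id k (C : linCat k) (X : C) : idm X = 0 -> is_zero X.
Proof.
move=> X0 Y; split=> f; [rewrite -(cmpm1 f) | rewrite -(cmp1m f)]; rewrite X0.
- exact: cmpm0.
- exact: cmp0m.
Qed.

Lemma isom_refl k (C : linCat k) (X : C) : isom X X.
Proof. by exists (idm X), (idm X); rewrite cmp1m. Qed.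

Lemma isom_sym k (C : linCat k) (X Y : C) : isom X Y -> isom Y X.
Proof. by move=> [f [g [gf fg]]]; exists g, f. Qed.

Lemma isom_trans k (C : linCat k) (X Y Z : C) :
  isom X Y -> isom Y Z -> isom X Z.
Proof.
move=> [f [f' [f'f ff']]] [g [g' [g'g gg']]]; exists (g \oc f), (f' \oc g').
split.
- by rewrite cmpA -(cmpA f' g' g) g'g cmpm1.
- by rewrite cmpA -(cmpA g f f') ff' cmpm1.
Qed.

Definition subTri k (D : triCat k) (P : D -> Prop) (PT : triSub P) : triCat k.
Proof.
refine (@TriCat k (fullsub P) _ _
  (fun X => exist P (sh (sval X)) (ts_sh PT (svalP X)))
  (fun X Y f => shm f)
  (fun X Y => @shm_lin k D (sval X) (sval Y))
  (fun X => shm_id (sval X))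
  (fun X Y Z g f => shm_cmp g f)
  (fun X Y => @shm_bij k D (sval X) (sval Y))
  (fun X => exist P (unsh (sval X)) (ts_unsh PT (svalP X)))
  (fun X => unshK (sval X))
  (fun X Y Z f g h => dist f g h) _ _ _ _ _ _).
- have [Z [Z0 PZ]] := ts_zero PT.
  by exists (exist P Z PZ) => Y; exact: Z0.
- move=> X Y; have [S BS] := tc_biprod (sval X) (sval Y).
  by exists (exist P S (ts_biprod PT BS (svalP X) (svalP Y))).
- move=> X Z Z0; apply: TR1_id; apply: is_zero_id.
  exact: (Z0 Z).1.
- move=> X Y f; have [Z [g [h T]]] := TR1_cone f.
  by exists (exist P Z (ts_cone PT T (svalP X) (svalP Y))), g, h.
- by move=> X Y Z X' Y' Z' f g h f' g' h' a b c; exact: TR1_iso.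
- by move=> X Y Z f g h; exact: TR2.
- by move=> X Y Z X' Y' Z' f g h f' g' h' a b; exact: TR3.
- by move=> X Y Z Q1 Q2 Q3 f g p1 d1 p2 d2 p3 d3; exact: TR4.
Defined.

Definition rorth k (D : triCat k) (E : D) : D -> Prop :=
  fun X => RHom_zero E X.

Definition lorth k (D : triCat k) (E : D) : D -> Prop :=
  fun X => RHom_zero X E.

Section Orthogonals.
Variables (k : fieldType) (D : triCat k).
Implicit Types X Y Z W : D.

Let hz X Y := forall f : hom X Y, f = 0.

Let hz_iso X X' Y Y' : isom X X' -> isom Y Y' -> hz X Y -> hz X' Y'.
Proof.
move=> [a [a' [_ aa']]] [b [b' [_ bb']]] H f.
have -> : f = b \oc (b' \oc f \oc a) \oc a'.
  by rewrite !cmpA bb' cmp1m -cmpA aa' cmpm1.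
by rewrite (H (b' \oc f \oc a)) cmpm0 cmp0m.
Qed.

Let shm0 X Y : shm (0 : hom X Y) = 0.
Proof.
have /(_ (-1) 0 0) := @shm_lin _ _ X Y.
by rewrite !scaler0 !addr0 scaleN1r addNr.
Qed.

Let hz_sh X Y : hz (sh X) (sh Y) <-> hz X Y.
Proof.
split=> H f; last first.
  by have [g _ gK] := shm_bij X Y; rewrite -(gK f) (H (g f)) shm0.
by apply: (bij_inj (shm_bij X Y)); rewrite shm0; exact: H.
Qed.

Let isom_sh X Y : isom X Y -> isom (sh X) (sh Y).
Proof.
move=> [f [g [gf fg]]]; exists (shm f), (shm g).
by rewrite -!shm_cmp gf fg !shm_id.
Qed.

Let sh_isom X Y : isom (sh X) (sh Y) -> isom X Y.
Proof.
move=> [f [g]]; have [f' _ fK] := shm_bij X Y; have [g' _ gK] := shm_bij Y X.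
rewrite -(fK f) -(gK g) -!shm_cmp -!shm_id => -[gf fg]; exists (f' f), (g' g).
by split; [apply: (bij_inj (shm_bij X X)) | apply: (bij_inj (shm_bij Y Y))].
Qed.

Let unsh_sh X : isom (unsh (sh X)) X.
Proof. by apply: sh_isom; exact: unshK. Qed.

Let isom_unsh X Y : isom X Y -> isom (unsh X) (unsh Y).
Proof.
move=> XY; apply: sh_isom.
apply: isom_trans (unshK X) _; apply: isom_trans XY _.
exact/isom_sym/unshK.
Qed.

Let isom_shn n X Y : isom X Y -> isom (shn n X) (shn n Y).
Proof.
move=> XY; case: n => n /=; first by elim: n => //= n; exact: isom_sh.
by apply: isom_unsh; elim: n => //= n; exact: isom_unsh.
Qed.

Let hz_shr X Y : hz X (sh Y) <-> hz (unsh X) Y.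
Proof.
split=> [H|/hz_sh H].
  by apply/hz_sh; apply: hz_iso H; [exact/isom_sym/unshK|exact: isom_refl].
by apply: hz_iso H; [exact: unshK|exact: isom_refl].
Qed.

Let hz_unshr X Y : hz X (unsh Y) <-> hz (sh X) Y.
Proof.
split=> [/hz_sh H|H].
  by apply: hz_iso H; [exact: isom_refl|exact: unshK].
by apply/hz_sh; apply: hz_iso H; [exact: isom_refl|exact/isom_sym/unshK].
Qed.

Let hz_shn n X Y : hz X (shn n Y) <-> hz (shn (- n) X) Y.
Proof.
case: n => n.
  rewrite -[X in _ <-> X]/(hz (shn (- n%:Z) X) Y).
  have -> : shn (- n%:Z) X = iter n unsh X by case: n.
  elim: n X => //= n IH X; apply: iff_trans (hz_shr _ _) _.
  by rewrite IH -iterSr.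
rewrite NegzE opprK; rewrite -NegzE /shn.
by elim: n.+1 X => //= m IH X; apply: iff_trans (hz_unshr _ _) _;
  rewrite IH -iterSr.
Qed.

Let shnS n X : isom (shn n (sh X)) (shn (n + 1) X).
Proof.
case: n => n.
  have -> : (n%:Z + 1) = n.+1 by rewrite -addn1 PoszD.
  by rewrite /shn -iterSr; exact: isom_refl.
have -> : (Negz n + 1) = - n%:Z by rewrite NegzE -addn1 PoszD opprD addrNK.
have -> : shn (- n%:Z) X = iter n unsh X by case: n.
rewrite /shn iterSr; elim: n => [|n IH] /=; first exact: unsh_sh.
exact: isom_unsh.
Qed.

Let unshnS n X : isom (shn n (unsh X)) (shn (n - 1) X).
Proof.
apply: isom_sym; apply: (isom_trans (isom_shn _ (isom_sym (unshK X)))).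
by have := shnS (n - 1) (unsh X); rewrite subrK.
Qed.

Let shift_shn n X : isom (sh (shn n X)) (shn (n + 1) X).
Proof.
case: n => n.
  have -> : (n%:Z + 1) = n.+1 by rewrite -addn1 PoszD.
  exact: isom_refl.
have -> : (Negz n + 1) = - n%:Z by rewrite NegzE -addn1 PoszD opprD addrNK.
have -> : shn (- n%:Z) X = iter n unsh X by case: n.
exact: unshK.
Qed.

Let unshift_shn n X : isom (unsh (shn n X)) (shn (n - 1) X).
Proof.
apply: sh_isom; apply: isom_trans (unshK _) _.
by have := isom_sym (shift_shn (n - 1) X); rewrite subrK.
Qed.

Let is_zero_sh Z : is_zero Z -> is_zero (sh Z).
Proof.
move=> Z0; apply: is_zero_id; rewrite -shm_id.
by rewrite ((Z0 Z).1 (idm Z)) shm0.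
Qed.

Let dist_homl X Y Z (f : hom X Y) (g : hom Y Z) (h : hom Z (sh X)) W
    (u : hom W Y) :
  dist f g h -> g \oc u = 0 -> exists v : hom W X, u = f \oc v.
Proof.
move=> T gu; have [O O0] := tc_zero D.
have T1 := (TR2 _ _ _).1 (TR1_id W O0); have T2 := (TR2 _ _ _).1 T.
have [|c [_]] := TR3 (a := u) (b := 0) T1 T2; first by rewrite cmp0m gu.
rewrite shm_id cmpmN cmpm1 cmpNm => /oppr_inj E.
have [s _ sK] := shm_bij W X; exists (s c).
by apply: (bij_inj (shm_bij W Y)); rewrite shm_cmp sK.
Qed.

Let dist_homr X Y Z (f : hom X Y) (g : hom Y Z) (h : hom Z (sh X)) W
    (u : hom Y W) :
  dist f g h -> u \oc f = 0 -> exists v : hom Z W, u = v \oc g.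
Proof.
move=> T uf; have [O O0] := tc_zero D.
have T1 : dist (0 : hom O W) (idm W) 0.
  by apply/TR2; rewrite shm0 oppr0; apply: TR1_id; exact: is_zero_sh.
have [|c [E _]] := TR3 (a := 0) (b := u) T T1; first by rewrite cmp0m uf.
by exists c; rewrite E cmp1m.
Qed.

Lemma triSub_rorth (E : D) : triSub (rorth E).
Proof.
have shP X : rorth E X -> rorth E (sh X).
  by move=> EX n; apply: hz_iso (isom_refl _) (isom_sym (shnS n X)) (EX _).
have E' X : rorth E X <-> forall n, hz (shn n E) X.
  split=> H n; last by apply/hz_shn; exact: H.
  by rewrite -[n]opprK; apply/hz_shn; exact: H.
split=> //.
- have [Z Z0] := tc_zero D; exists Z; split=> //.
  by apply/E' => n; exact: (Z0 _).2.
- move=> X Y XY EX n.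
  exact: hz_iso (isom_refl _) (isom_shn n XY) (EX n).
- move=> X Y S [i1 [i2 [p1 [p2 [_ _ _ _ e]]]]] /E' EX /E' EY; apply/E' => n f.
  have cl := @cmp_linl _ _ _ _ _ f 1 (i1 \oc p1) (i2 \oc p2).
  rewrite -[f]cmp1m -e; move: cl; rewrite !scale1r => ->.
  by rewrite -!cmpA (EX n (p1 \oc f)) (EY n (p2 \oc f)) !cmpm0 addr0.
- by move=> X EX n; apply: hz_iso (isom_refl _) (isom_sym (unshnS n X)) (EX _).
- move=> X Y Z f g h T EX /E' EY; apply/E' => n u.
  have hu : h \oc u = 0 by move/shP/E': EX => /(_ n); apply.
  have [v ->] := dist_homl ((TR2 _ _ _).1 T) hu.
  by rewrite (EY n v) cmpm0.
Qed.

Lemma triSub_lorth (E : D) : triSub (lorth E).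
Proof.
have shP X : lorth E X -> lorth E (sh X).
  move=> EX n; apply/hz_unshr.
  exact: hz_iso (isom_refl _) (isom_sym (unshift_shn n E)) (EX _).
split=> //.
- have [Z Z0] := tc_zero D; exists Z; split=> //.
  by move=> n; exact: (Z0 _).1.
- by move=> X Y XY EX n; exact: hz_iso XY (isom_refl _) (EX n).
- move=> X Y S [i1 [i2 [p1 [p2 [_ _ _ _ e]]]]] EX EY n f.
  have cl := @cmp_linr _ _ _ _ _ f 1 (i1 \oc p1) (i2 \oc p2).
  rewrite -[f]cmpm1 -e; move: cl; rewrite !scale1r => ->.
  by rewrite !cmpA (EX n (f \oc i1)) (EY n (f \oc i2)) !cmp0m addr0.
- move=> X EX n; apply/hz_shr.
  exact: hz_iso (isom_refl _) (isom_sym (shift_shn n E)) (EX _).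
- move=> X Y Z f g h T EX EY n u.
  have ug : u \oc g = 0 by exact: EY.
  have [v ->] := dist_homr ((TR2 _ _ _).1 T) ug.
  by rewrite (shP _ EX n v) cmp0m.
Qed.

End Orthogonals.

Definition rorthCat k (D : triCat k) (E : D) : triCat k :=
  subTri (triSub_rorth E).

Definition lorthCat k (D : triCat k) (E : D) : triCat k :=
  subTri (triSub_lorth E).

(* D = <D1, D2>, with the convention RHom(D2, D1) = 0. *)
Definition semiorthogonal k (D : triCat k) (D1 D2 : D -> Prop) :=
  [/\ triSub D1, triSub D2,
      forall X2 X1 : D, D2 X2 -> D1 X1 -> RHom_zero X2 X1
    & forall X : D, exists (X2 X1 : D) (f : hom X2 X) (g : hom X X1)
        (h : hom X1 (sh X2)), [/\ D2 X2, D1 X1 & dist f g h]].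

Record tpair k (D : triCat k) := TPair {
  tle : D -> Prop;
  tge : D -> Prop
}.

(* The members of a t-structure are closed under isomorphism, so that
   X lies in S[n] if and only if X[-n] lies in S. *)
Record is_tstruct k (D : triCat k) (t : tpair D) : Prop := IsTStruct {
  tle_iso : forall X Y : D, isom X Y -> tle t X -> tle t Y;
  tge_iso : forall X Y : D, isom X Y -> tge t X -> tge t Y;
  tle_sh : forall X : D, tle t X -> tle t (sh X);
  tge_unsh : forall X : D, tge t X -> tge t (unsh X);
  t_orth : forall X Y : D, tle t X -> tge t Y ->
    forall f : hom X (unsh Y), f = 0;
  t_trunc : forall X : D, exists (A B : D)
    (f : hom A X) (g : hom X (unsh B)) (h : hom (unsh B) (sh A)),
    [/\ tle t A, tge t B & dist f g h]
}.

Definition shifted k (D : triCat k) (S : D -> Prop) (n : int) : D -> Prop :=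
  fun X => exists Y : D, S Y /\ isom (shn n Y) X.

Definition tbounded k (D : triCat k) (t : tpair D) :=
  forall X : D, exists a b : int,
    shifted (tge t) (- a) X /\ shifted (tle t) (- b) X.

Definition heart k (D : triCat k) (t : tpair D) : linCat k :=
  fullsub (fun X : D => tle t X /\ tge t X).

Definition tnoetherian k (D : triCat k) (t : tpair D) := noetherian (heart t).

Definition tartinian k (D : triCat k) (t : tpair D) := artinian (heart t).

Definition timage k (D D' : triCat k) (F : functor D D') (t : tpair D) :
    tpair D' :=
  TPair (ess_image F (tle t)) (ess_image F (tge t)).

(* The subgroup of the free abelian group on the objects generated by the
   [Y] - [X] - [Z] for X -> Y -> Z -> X[1] distinguished. *)
Definition K0rel k (D : triCat k) : {pred {freeg {classic D} / int}} :=
  fun x => `[< forall S : {pred {freeg {classic D} / int}},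
    zmod_closed S ->
    (forall (X Y Z : D) (f : hom X Y) (g : hom Y Z) (h : hom Z (sh X)),
      dist f g h ->
      (<< (Y : {classic D}) >> - << (X : {classic D}) >>
        - << (Z : {classic D}) >>) \in S) ->
    x \in S >].

Lemma K0rel_closed k (D : triCat k) : zmod_closed (@K0rel k D).
Proof.
split=> [|x y /asboolP Hx /asboolP Hy]; apply/asboolP => S cS HS.
  by case: cS.
by case: (cS) => _; apply; [exact: Hx|exact: Hy].
Qed.

HB.instance Definition _ k (D : triCat k) :=
  GRing.isZmodClosed.Build {freeg {classic D} / int} (@K0rel k D)
    (@K0rel_closed k D).

Definition K0 k (D : triCat k) : zmodType :=
  Quotient.quot (@K0rel k D : zmodClosed _).

Definition K0class k (D : triCat k) (X : D) : K0 D :=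
  (\pi_(K0 D) (<< (X : {classic D}) >> : {freeg {classic D} / int}))%qT.

Lemma K0class_dist k (D : triCat k) (X Y Z : D)
    (f : hom X Y) (g : hom Y Z) (h : hom Z (sh X)) :
  dist f g h -> K0class Y = K0class X + K0class Z.
Proof.
move=> T; rewrite /K0class; set y := << _ >>; set x := << _ >>; set z := << _ >>.
have <- : \pi_(K0 D)%qT (x + z) = \pi_(K0 D)%qT x + \pi_(K0 D)%qT z.
  exact: Quotient.pi_add.
apply/eqP; rewrite -Quotient.idealrBE; apply/asboolP => S cS HS.
by rewrite opprD addrA; exact: HS T.
Qed.

Definition free_of_finite_rank (L : zmodType) :=
  exists (r : nat) (f : {additive L -> 'rV[int]_r}), bijective f.

(* [z] lies on the open ray spanned by exp(i pi phi), and 0 < phi <= 1. *)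
Definition has_phase (R : realType) (z : R[i]) (phi : R) :=
  0 < phi <= 1 /\
  exists2 m : R, 0 < m & z = (m * cos (pi * phi)) +i* (m * sin (pi * phi)).

(* In an abelian category [C], with [W A] the central charge of [A]:
   [A] is (semi)stable, of phase [phi]. *)
Definition semistable (R : realType) k (C : linCat k) (W : C -> R[i])
    (A : C) (phi : R) :=
  [/\ ~ is_zero A, has_phase (W A) phi
    & forall (A' : C) (i : hom A' A), mono i -> ~ is_iso i -> ~ is_zero A' ->
      forall phi', has_phase (W A') phi' -> phi' <= phi].

Definition stable (R : realType) k (C : linCat k) (W : C -> R[i])
    (A : C) (phi : R) :=
  [/\ ~ is_zero A, has_phase (W A) phi
    & forall (A' : C) (i : hom A' A), mono i -> ~ is_iso i -> ~ is_zero A' ->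
      forall phi', has_phase (W A') phi' -> phi' < phi].

(* A filtration 0 = F 0 -> F 1 -> ... -> F m = A by monomorphisms; the data
   with index beyond [m] is irrelevant. *)
Definition has_HN (R : realType) k (C : linCat k) (W : C -> R[i]) (A : C) :=
  exists (m : nat) (F : nat -> C) (i : forall j, hom (F j) (F j.+1))
      (Q : nat -> C) (q : forall j, hom (F j.+1) (Q j)) (phi : nat -> R),
    [/\ is_zero (F 0%N), isom (F m) A,
        forall j, (j < m)%N ->
          [/\ mono (i j), is_coker (i j) (q j) & semistable W (Q j) (phi j)]
      & forall j, (j.+1 < m)%N -> phi j.+1 < phi j].

Definition heart_charge (R : realType) k (D : triCat k) (L : zmodType)
    (v : {additive K0 D -> L}) (t : tpair D) (Z : {additive L -> R[i]}) :
    heart t -> R[i] :=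
  fun A => Z (v (K0class (sval A))).

Record prestab (R : realType) k (D : triCat k) (L : zmodType)
    (v : {additive K0 D -> L}) := PreStab {
  ps_t : tpair D;
  ps_Z : {additive L -> R[i]};
  ps_tstruct : is_tstruct ps_t;
  ps_bounded : tbounded ps_t;
  ps_phase : forall A : heart ps_t, ~ is_zero A ->
    exists phi : R, has_phase (heart_charge v ps_Z A) phi;
  ps_HN : forall A : heart ps_t, ~ is_zero A ->
    has_HN (@heart_charge R k D L v ps_t ps_Z) A
}.

(* The shift A[n] of a stable object A of the heart, of phase psi in (0, 1],
   is stable of phase psi + n. *)
Definition stable_of_phase (R : realType) k (D : triCat k) (L : zmodType)
    (v : {additive K0 D -> L}) (s : prestab R v) (E : D) (phi : R) :=
  exists (A : heart (ps_t s)) (n : int) (psi : R),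
    [/\ stable (@heart_charge R k D L v (ps_t s) (ps_Z s)) A psi,
        isom E (shn n (sval A)) & phi = psi + n%:~R].

(* Main.v *)
Require Import Defs.
From mathcomp Require Import all_boot all_order all_algebra.
From mathcomp Require Import boolp reals trigo complex.
(* [hom] below is the space of morphisms of a category, not that of linear maps
   between vector spaces. *)
Import Defs.

Set Implicit Arguments.
Unset Strict Implicit.
Unset Printing Implicit Defensive.

Import Order.TTheory GRing.Theory Num.Theory.
Local Open Scope ring_scope.

(** Let A be the heart of the given t-structure.  A subobject of E in A and the
    quotient by it have central charges whose imaginary parts are nonnegative
    and add up to that of E, namely 0.  A proper nonzero subobject would thus
    have phase 1, against stability, so E is a simple object of A
    ([stable_simple]).

    Let B be the right and C the left orthogonal of E in the ambient category D.
    For X in D^{>=0}, the maps from shifts of E to X can be killed one at a time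
    by passing to cones of nonzero maps E[-n] -> X.  As RHom(E, E) is the base
    field, each such cone has an RHom(E, -) of total dimension one less, so
    finitely many steps produce the reflection of X in B.  The cones stay in
    D^{>=0}: for n > 0 they are extensions of E[1-n] by X, and for n = 0 the map
    E -> H^0(X) is injective because E is simple.  Hence reflection preserves
    D^{>=0} ([rorth_reflection]).  Dually, coreflection in C preserves D^{<=0}
    ([lorth_coreflection]).

    This exactness is all that is needed for the projected pair on B to be a
    t-structure: its coaisle is the intersection of D^{>=0} with B,
    orthogonality is the universal property of the reflection, and the
    truncation triangle of an object of B is the reflection of its truncation
    triangle in D ([left_projection_tstruct]).  Objects of B are reflections of
    themselves, so bounds in D are bounds in B.  The case of C is dual.

    For the chain conditions, the subobjects of an object in a projected heart
    are embedded, as an ordered set, in the subobjects of an object of A.  For B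
    the truncation H^0 from the projected heart to A is fully faithful and right
    adjoint to reflection, so it preserves monomorphisms ([left_heart_embed]).
    For C the truncation H^0 is left adjoint to coreflection, which makes it
    preserve epimorphisms instead; a subobject Y of X is then sent to the kernel
    of H^0(X) -> H^0(X/Y) ([right_heart_embed]). *)

(** * Hom spaces and shifts *)

Section HomSpaces.
Variables (k : fieldType) (C : linCat k).
Implicit Types X Y Z : C.

Definition hz X Y := forall f : hom X Y, f = 0.

Lemma cmpDm X Y Z (f g : hom Y Z) (u : hom X Y) :
  (f + g) \oc u = f \oc u + g \oc u.
Proof. by have := cmp_linl u 1 f g; rewrite !scale1r. Qed.

Lemma cmpmD X Y Z (f : hom Y Z) (u v : hom X Y) :
  f \oc (u + v) = f \oc u + f \oc v.
Proof. by have := cmp_linr f 1 u v; rewrite !scale1r. Qed.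

Lemma cmpZm X Y Z a (f : hom Y Z) (u : hom X Y) :
  (a *: f) \oc u = a *: (f \oc u).
Proof. by have := cmp_linl u a f 0; rewrite !addr0 cmp0m addr0. Qed.

Lemma cmpmZ X Y Z a (f : hom Y Z) (u : hom X Y) :
  f \oc (a *: u) = a *: (f \oc u).
Proof. by have := cmp_linr f a u 0; rewrite !addr0 cmpm0 addr0. Qed.

Lemma cmpmB X Y Z (f : hom Y Z) (u v : hom X Y) :
  f \oc (u - v) = f \oc u - f \oc v.
Proof. by rewrite cmpmD cmpmN. Qed.

Lemma cmpBm X Y Z (f g : hom Y Z) (u : hom X Y) :
  (f - g) \oc u = f \oc u - g \oc u.
Proof. by rewrite cmpDm cmpNm. Qed.

Lemma is_iso_id X : is_iso (idm X).
Proof. by exists (idm X); rewrite cmp1m. Qed.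

Lemma hz_iso X X' Y Y' : isom X X' -> isom Y Y' -> hz X Y -> hz X' Y'.
Proof.
move=> [a [a' [_ aa']]] [b [b' [_ bb']]] H f.
have -> : f = b \oc (b' \oc f \oc a) \oc a'.
  by rewrite !cmpA bb' cmp1m -cmpA aa' cmpm1.
by rewrite (H (b' \oc f \oc a)) cmpm0 cmp0m.
Qed.

Lemma hz_isol X X' Y : isom X X' -> hz X Y -> hz X' Y.
Proof. by move=> i; apply: hz_iso => //; exact: isom_refl. Qed.

Lemma hz_isor X Y Y' : isom Y Y' -> hz X Y -> hz X Y'.
Proof. by move=> i; apply: hz_iso => //; exact: isom_refl. Qed.

End HomSpaces.

Section Shifts.
Variables (k : fieldType) (D : triCat k).
Implicit Types X Y Z W : D.

Lemma shm0 X Y : shm (0 : hom X Y) = 0.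
Proof.
have /(_ (-1) 0 0) := @shm_lin _ _ X Y.
by rewrite !scaler0 !addr0 scaleN1r addNr.
Qed.

Lemma shmN X Y (f : hom X Y) : shm (- f) = - shm f.
Proof. by have := @shm_lin _ _ X Y (-1) f 0; rewrite shm0 !addr0 !scaleN1r. Qed.

Lemma shmZ X Y a (f : hom X Y) : shm (a *: f) = a *: shm f.
Proof. by have := @shm_lin _ _ X Y a f 0; rewrite shm0 !addr0. Qed.

Lemma shm_inj X Y : injective (@shm k D X Y).
Proof. exact: bij_inj (shm_bij X Y). Qed.

Lemma shm_full X Y (f : hom (sh X) (sh Y)) : exists g, f = shm g.
Proof. by have [s _ sK] := shm_bij X Y; exists (s f). Qed.

Lemma shm_fullN X Y (f : hom (sh X) (sh Y)) : exists g, f = - shm g.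
Proof. by have [g ->] := shm_full f; exists (- g); rewrite shmN opprK. Qed.

Lemma hz_sh X Y : hz (sh X) (sh Y) <-> hz X Y.
Proof.
split=> H f; last by have [g ->] := shm_full f; rewrite (H g) shm0.
by apply: shm_inj; rewrite shm0; exact: H.
Qed.

Lemma isom_sh X Y : isom X Y -> isom (sh X) (sh Y).
Proof.
move=> [f [g [gf fg]]]; exists (shm f), (shm g).
by rewrite -!shm_cmp gf fg !shm_id.
Qed.

Lemma sh_isom X Y : isom (sh X) (sh Y) -> isom X Y.
Proof.
move=> [f [g]]; have [f' ->] := shm_full f; have [g' ->] := shm_full g.
rewrite -!shm_cmp -!shm_id => -[gf fg]; exists f', g'.
by split; exact: shm_inj.
Qed.

Lemma unsh_sh X : isom (unsh (sh X)) X.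
Proof. by apply: sh_isom; exact: unshK. Qed.

Lemma shn_succ n X : isom (sh (shn n X)) (shn (n + 1) X).
Proof.
case: n => n.
  have -> : (n%:Z + 1) = n.+1 by rewrite -addn1 PoszD.
  exact: isom_refl.
have -> : (Negz n + 1) = - n%:Z by rewrite NegzE -addn1 PoszD opprD addrNK.
have -> : shn (- n%:Z) X = iter n unsh X by case: n.
exact: unshK.
Qed.

(** Shifting both arguments by one changes nothing, so only the difference of
    the two shifts matters. *)
Lemma hz_shn_cancel X Y (m n : int) :
  hz (shn m X) (shn n Y) <-> hz X (shn (n - m) Y).
Proof.
have S a b : hz (shn a X) (shn b Y) <-> hz (shn (a + 1) X) (shn (b + 1) Y).
  apply: iff_trans (iff_sym (hz_sh _ _)) _.
  split; apply: hz_iso; try exact: shn_succ; exact/isom_sym/shn_succ.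
have P (j : nat) : forall a b,
    hz (shn a X) (shn b Y) <-> hz (shn (a + j%:Z) X) (shn (b + j%:Z) Y).
  elim: j => [|j IH] a b; first by rewrite !addr0.
  by rewrite (IH a b) (S (a + j) (b + j)) -!addrA -PoszD addn1.
case: m => m.
  by have := P m 0 (n - m%:Z); rewrite add0r subrK => <-.
by have := P m.+1 (Negz m) n; rewrite NegzE addNr opprK => ->.
Qed.

End Shifts.

(** * Long exact sequences *)

Section Triangles.
Variables (k : fieldType) (D : triCat k).
Implicit Types X Y Z W : D.

Lemma is_zero_sh Z : is_zero Z -> is_zero (sh Z).
Proof.
by move=> Z0; apply: is_zero_id; rewrite -shm_id ((Z0 Z).1 (idm Z)) shm0.
Qed.

Lemma dist_rot X Y Z (f : hom X Y) (g : hom Y Z) (h : hom Z (sh X)) :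
  dist f g h -> dist g h (- shm f).
Proof. by move/TR2. Qed.

Lemma dist_sh X Y Z (f : hom X Y) (g : hom Y Z) (h : hom Z (sh X)) :
  dist f g h <-> dist (- shm f) (- shm g) (- shm h).
Proof. by rewrite TR2 TR2 TR2. Qed.

Lemma dist_isol X Y Z X' (f : hom X Y) (g : hom Y Z) (h : hom Z (sh X))
    (a : hom X' X) (a' : hom X X') :
  a \oc a' = idm X -> a' \oc a = idm X' ->
  dist f g h -> dist (f \oc a) g (shm a' \oc h).
Proof.
move=> aa' a'a.
apply: (TR1_iso (a := a') _ (is_iso_id _) (is_iso_id _)); first by exists a.
- by rewrite cmp1m -cmpA aa' cmpm1.
- by rewrite cmp1m cmpm1.
- by rewrite cmpm1.
Qed.

Lemma dist_isom X Y Z Y' (f : hom X Y) (g : hom Y Z) (h : hom Z (sh X))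
    (b : hom Y Y') (b' : hom Y' Y) :
  b \oc b' = idm Y' -> b' \oc b = idm Y ->
  dist f g h -> dist (b \oc f) (g \oc b') h.
Proof.
move=> bb' b'b.
apply: (TR1_iso (b := b) (is_iso_id _) _ (is_iso_id _)); first by exists b'.
- by rewrite cmpm1.
- by rewrite cmp1m -cmpA b'b cmpm1.
- by rewrite shm_id cmp1m cmpm1.
Qed.

Lemma dist_isor X Y Z Z' (f : hom X Y) (g : hom Y Z) (h : hom Z (sh X))
    (c : hom Z Z') (c' : hom Z' Z) :
  c \oc c' = idm Z' -> c' \oc c = idm Z ->
  dist f g h -> dist f (c \oc g) (h \oc c').
Proof.
move=> cc' c'c.
apply: (TR1_iso (c := c) (is_iso_id _) (is_iso_id _)); first by exists c'.
- by rewrite cmp1m cmpm1.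
- by rewrite cmpm1.
- by rewrite shm_id cmp1m -cmpA c'c cmpm1.
Qed.

Section LongExact.
Variables (X Y Z : D) (f : hom X Y) (g : hom Y Z) (h : hom Z (sh X)).
Hypothesis T : dist f g h.

Lemma dist_lift1 W (u : hom W Y) : g \oc u = 0 -> exists v, u = f \oc v.
Proof.
move=> gu; have [O O0] := tc_zero D.
have T1 := dist_rot (TR1_id W O0); have T2 := dist_rot T.
have [|c [_]] := TR3 (a := u) (b := 0) T1 T2; first by rewrite cmp0m gu.
rewrite shm_id cmpmN cmpm1 cmpNm => /oppr_inj e.
have [s es] := shm_full c; exists s.
by apply: shm_inj; rewrite shm_cmp -es.
Qed.

Lemma dist_desc1 W (u : hom Y W) : u \oc f = 0 -> exists v, u = v \oc g.
Proof.
move=> uf; have [O O0] := tc_zero D.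
have T1 : dist (0 : hom O W) (idm W) 0.
  by apply/TR2; rewrite shm0 oppr0; apply: TR1_id; exact: is_zero_sh.
have [|c [e _]] := TR3 (a := 0) (b := u) T T1; first by rewrite cmp0m uf.
by exists c; rewrite e cmp1m.
Qed.

Lemma dist_cmp1 : g \oc f = 0.
Proof.
have [O O0] := tc_zero D.
have [|c [e _]] := TR3 (a := idm X) (b := f) (TR1_id X O0) T.
  by rewrite cmpm1.
by rewrite -e cmpm0.
Qed.

End LongExact.

Section LongExactRotated.
Variables (X Y Z : D) (f : hom X Y) (g : hom Y Z) (h : hom Z (sh X)).
Hypothesis T : dist f g h.

Lemma dist_cmp2 : h \oc g = 0.
Proof. exact: dist_cmp1 (dist_rot T). Qed.

Lemma dist_cmp3 : shm f \oc h = 0.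
Proof.
have := dist_cmp1 (dist_rot (dist_rot T)).
by rewrite cmpNm => /eqP; rewrite oppr_eq0 => /eqP.
Qed.

Lemma dist_lift2 W (u : hom W Z) : h \oc u = 0 -> exists v, u = g \oc v.
Proof. exact: (dist_lift1 (dist_rot T)). Qed.

Lemma dist_lift3 W (u : hom W (sh X)) :
  shm f \oc u = 0 -> exists v, u = h \oc v.
Proof.
by move=> e; apply: (dist_lift1 (dist_rot (dist_rot T))); rewrite cmpNm e oppr0.
Qed.

Lemma dist_desc2 W (u : hom Z W) : u \oc g = 0 -> exists v, u = v \oc h.
Proof. exact: (dist_desc1 (dist_rot T)). Qed.

Lemma dist_desc3 W (u : hom (sh X) W) :
  u \oc h = 0 -> exists v, u = v \oc shm f.
Proof.
move=> /(dist_desc1 (dist_rot (dist_rot T)))[v ->]; exists (- v).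
by rewrite cmpmN cmpNm.
Qed.

Lemma hz_dist_mid W : hz W X -> hz W Z -> hz W Y.
Proof.
move=> WX WZ u; have [|v ->] := dist_lift1 T (u := u); first exact: WZ.
by rewrite (WX v) cmpm0.
Qed.

Lemma hz_mid_dist W : hz X W -> hz Z W -> hz Y W.
Proof.
move=> WX WZ u; have [|v ->] := dist_desc1 T (u := u); first exact: WX.
by rewrite (WZ v) cmp0m.
Qed.

Lemma dist_zero_iso : is_zero Z -> is_iso f.
Proof.
move=> Z0.
have [|s es] := dist_lift1 T (u := idm Y); first by rewrite ((Z0 _).2 g) cmp0m.
exists s; split=> //; apply/eqP; rewrite -subr_eq0; apply/eqP/shm_inj.
rewrite shm0; have [|v ->] := @dist_lift3 _ (shm (s \oc f - idm X)).
  by rewrite -shm_cmp cmpmB cmpA -es cmp1m cmpm1 subrr shm0.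
by rewrite ((Z0 _).1 h) cmp0m.
Qed.

Lemma dist_iso_zero : is_iso f -> is_zero Z.
Proof.
move=> [s [sf fs]]; apply: is_zero_id.
have g0 : g = 0 by rewrite -(cmpm1 g) -fs cmpA (dist_cmp1 T) cmp0m.
have h0 : h = 0.
  by rewrite -(cmp1m h) -shm_id -sf shm_cmp -cmpA dist_cmp3 cmpm0.
have [|v ->] := @dist_lift2 _ (idm Z); first by rewrite h0 cmp0m.
by rewrite g0 cmp0m.
Qed.

End LongExactRotated.

Lemma dist_fiber Y Z (g : hom Y Z) :
  exists (X : D) (f : hom X Y) (h : hom Z (sh X)), dist f g h.
Proof.
have [K [p [q T]]] := TR1_cone g.
have [c [c' [c'c cc']]] := isom_sym (unshK K).
have [f ef] := shm_fullN (q \oc c').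
exists (unsh K), f, (c \oc p); apply/TR2; rewrite -ef.
exact: dist_isor T.
Qed.

Lemma dist_id_zero X : exists (Z : D) (g : hom X Z) (h : hom Z (sh X)),
  is_zero Z /\ dist (idm X) g h.
Proof.
have [Z Z0] := tc_zero D; exists Z, 0, 0; split=> //; exact: TR1_id.
Qed.

End Triangles.

(** * t-structures *)

Section TStructures.
Variables (k : fieldType) (D : triCat k) (t : tpair D).
Hypothesis ht : is_tstruct t.
Implicit Types X Y Z W A B : D.

Lemma tge_sh_unsh Y : tge t Y -> tge t (sh (unsh Y)).
Proof. exact/(tge_iso ht)/isom_sym/unshK. Qed.

Lemma hz_tle_tge X Y : tle t X -> tge t (sh Y) -> hz X Y.
Proof.
by move=> lX gY; apply: hz_isor (unsh_sh Y) _; exact: t_orth ht _ _ lX gY.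
Qed.

Lemma hz_sh_tge X Y : tle t X -> tge t Y -> hz (sh X) Y.
Proof.
move=> lX gY; apply: hz_isor (unshK Y) _; apply/hz_sh.
by apply: hz_tle_tge => //; exact: tge_sh_unsh.
Qed.

Lemma t_trunc1 X : exists (A B : D) (f : hom A X) (g : hom X B)
  (h : hom B (sh A)), [/\ tle t A, tge t (sh B) & dist f g h].
Proof.
have [A [B [f [g [h [lA gB T]]]]]] := t_trunc ht X.
by exists A, (unsh B), f, g, h; split=> //; exact: tge_sh_unsh.
Qed.

(** The aisle and the coaisle determine each other by orthogonality: if [X] is
    orthogonal to the coaisle, its map to the second vertex of its truncation
    triangle vanishes, and then so does that vertex. *)
Lemma tleP X : (forall Y, tge t (sh Y) -> hz X Y) -> tle t X.
Proof.
move=> H; have [A [B [f [g [h [lA gB T]]]]]] := t_trunc1 X.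
have B0 : is_zero B.
  apply: is_zero_id; have [|v ->] := dist_desc2 T (u := idm B).
    by rewrite (H _ gB g) cmpm0.
  by rewrite (hz_tle_tge (tle_sh ht lA) gB v) cmp0m.
by apply: tle_iso lA => //; exists f; exact: dist_zero_iso T B0.
Qed.

Lemma tgeP Y : (forall X, tle t X -> hz (sh X) Y) -> tge t Y.
Proof.
move=> H; have [A [B [f [g [h [lA gB T]]]]]] := t_trunc1 (unsh Y).
have f0 : f = 0.
  suff: hz A (unsh Y) by [].
  by apply/hz_sh; apply: hz_isor (isom_sym (unshK Y)) _; exact: H.
have A0 : is_zero (sh A).
  apply: is_zero_id; have [|v ->] := dist_lift3 T (u := idm (sh A)).
    by rewrite f0 shm0 cmp0m.
  by rewrite (hz_tle_tge (tle_sh ht lA) gB v) cmpm0.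
apply: tge_iso gB => //; apply: isom_trans (unshK Y).
apply/isom_sym/isom_sh; exists g; exact: dist_zero_iso (dist_rot T) A0.
Qed.

Lemma tle_unshP X : (forall Y, tge t Y -> hz X Y) -> tle t (unsh X).
Proof.
move=> H; apply: tleP => Y gY; apply/hz_sh.
apply: hz_isol (isom_sym (unshK X)) _; exact: H.
Qed.

Lemma tle_ext X Y Z (f : hom X Y) (g : hom Y Z) (h : hom Z (sh X)) :
  dist f g h -> tle t X -> tle t Z -> tle t Y.
Proof.
by move=> T lX lZ; apply: tleP => V gV; apply: (hz_mid_dist T);
  exact: hz_tle_tge.
Qed.

Lemma tge_ext X Y Z (f : hom X Y) (g : hom Y Z) (h : hom Z (sh X)) :
  dist f g h -> tge t X -> tge t Z -> tge t Y.
Proof.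
by move=> T lX lZ; apply: tgeP => V gV; apply: (hz_dist_mid T);
  exact: hz_sh_tge.
Qed.

Lemma tle_shn X (n : nat) : tle t X -> tle t (shn n X).
Proof. by elim: n => //= n IH /IH; exact: tle_sh. Qed.

Lemma tge_iter_unsh X (n : nat) : tge t X -> tge t (iter n unsh X).
Proof. by elim: n => //= n IH /IH; exact: tge_unsh. Qed.

Lemma t_trunc0 X : exists (A B : D) (f : hom (sh A) X) (g : hom X B)
  (h : hom B (sh (sh A))), [/\ tle t A, tge t B & dist f g h].
Proof.
have [A [B [a [b [c [lA gB T]]]]]] := t_trunc1 (unsh X).
have [e [e' [e'e ee']]] := unshK X.
exists A, (sh B), (e \oc - shm a), (- shm b \oc e'), (- shm c); split=> //.
exact: dist_isom ee' e'e ((dist_sh _ _ _).1 T).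
Qed.

Lemma tge_fiber X Y Z (f : hom X Y) (g : hom Y Z) (h : hom Z (sh X)) :
  dist f g h -> tge t Y -> tge t Z -> tge t X.
Proof.
move=> T gY gZ; apply: tgeP => W lW w; apply: shm_inj; rewrite shm0.
have [|v ->] := dist_lift3 T (u := shm w).
  by rewrite -shm_cmp (hz_sh_tge lW gY (f \oc w)) shm0.
by rewrite (hz_sh_tge (tle_sh ht lW) gZ v) cmpm0.
Qed.

(** A map whose cone lies in the coaisle is a monomorphism for the heart: a
    kernel would come from a map of [sh W] to [Z]. *)
Lemma dist_mono_tle X Y Z (f : hom X Y) (g : hom Y Z) (h : hom Z (sh X)) W
    (x : hom W X) :
  dist f g h -> tge t Z -> tle t W -> f \oc x = 0 -> x = 0.
Proof.
move=> T gZ lW fx; apply: shm_inj; rewrite shm0.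
have [|v ->] := dist_lift3 T (u := shm x); first by rewrite -shm_cmp fx shm0.
by rewrite (hz_sh_tge lW gZ v) cmpm0.
Qed.

(** The cohomology of the cone in degree -1 is a subobject of [X] in the heart
    annihilated by [i], hence zero. *)
Lemma heart_mono_cone (X Y : heart t) (i : hom X Y) (K : D)
    (p : hom (sval Y) K) (q : hom K (sh (sval X))) :
  mono i -> @dist _ D _ _ _ i p q -> tle t K /\ tge t K.
Proof.
case: X Y i p q => [X [lX gX]] [Y [lY gY]] /= i p q mi T.
have lK : tle t K := tle_ext (dist_rot T) lY (tle_sh ht lX).
have [A [B [a [b [c [lA gB T']]]]]] := t_trunc0 K.
have K1 V : tle t V -> hz (sh (sh V)) K.
  move=> lV; apply: (hz_dist_mid (dist_rot T)).
    by apply: hz_sh_tge => //; exact: tle_sh.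
  by apply/hz_sh; exact: hz_sh_tge.
have gA : tge t A.
  apply: tgeP => V lV w; do 2!apply: shm_inj; rewrite !shm0.
  have [|v ->] := dist_lift3 T' (u := shm (shm w)).
    by rewrite -shm_cmp (K1 V lV (a \oc shm w)) shm0.
  by rewrite (hz_sh_tge (tle_sh ht (tle_sh ht lV)) gB v) cmpm0.
(* [r : A -> X] is the inclusion of the kernel of [i]. *)
have [r er] := shm_full (q \oc a).
have ir : i \oc r = 0.
  by apply: shm_inj; rewrite shm_cmp -er shm0 cmpA (dist_cmp3 T) cmp0m.
have r0 : r = 0.
  by apply: (mi (exist _ A (conj lA gA)) r 0); rewrite cmpm0.
have [|v a0] := dist_lift2 T (u := a); first by rewrite er r0 shm0.
have {v}a0 : a = 0 by rewrite a0 (hz_sh_tge lA gY v) cmpm0.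
split=> //; apply: tgeP => W lW w.
have [|v ->] := dist_lift1 T' (u := w); last by rewrite a0 cmp0m.
exact: hz_sh_tge.
Qed.

End TStructures.

(** * Stable objects of phase one are simple *)

(** The last clause says that every nonzero map from [W] to [E] is an
    epimorphism on cohomology in degree 0.  Testing all [W] of the aisle, and
    not only those of the heart, makes it unnecessary to form images. *)
Definition simple_heart k (D : triCat k) (t : tpair D) (E : D) :=
  [/\ tle t E, tge t E
    & forall (W K : D) (w : hom W E) (p : hom E K) (q : hom K (sh W)),
        tle t W -> w <> 0 -> dist w p q -> tle t (unsh K)].

Section Phases.
Variable R : realType.
Implicit Types (z : R[i]) (phi : R).

Lemma has_phase_Im_ge0 z phi : has_phase z phi -> 0 <= complex.Im z.
Proof.
move=> [/andP[p0 p1] [m m0 ->]] /=; apply: mulr_ge0; first exact: ltW.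
by apply: sin_ge0_pi; rewrite pmulr_rge0 ?pi_gt0 // ltW //= ger_pMr ?pi_gt0.
Qed.

Lemma has_phase_Im_gt0 z phi : has_phase z phi -> phi < 1 -> 0 < complex.Im z.
Proof.
move=> [/andP[p0 _] [m m0 ->]] p1 /=; apply: mulr_gt0 => //.
by apply: sin_gt0_pi; rewrite pmulr_rgt0 ?pi_gt0 // p0 /= gtr_pMr ?pi_gt0.
Qed.

Lemma has_phase1_Im z : has_phase z 1 -> complex.Im z = 0.
Proof. by move=> [_ [m _ ->]] /=; rewrite mulr1 sinpi mulr0. Qed.

End Phases.

Section StableSimple.
Variables (R : realType) (k : fieldType) (D : triCat k) (L : zmodType).
Variables (v : {additive K0 D -> L}) (sigma : prestab R v).
Let t := ps_t sigma.
Let ht : is_tstruct t := ps_tstruct sigma.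
Let charge := @heart_charge R k D L v t (ps_Z sigma).

(** If [w] were not an epimorphism, its image [I] would be a proper nonzero
    subobject; as the imaginary part of the central charge is additive,
    nonnegative on the heart and zero on [E], the phase of [I] would be 1,
    against stability. *)
Lemma stable_simple (E : heart t) :
  stable charge E 1 -> simple_heart t (sval E).
Proof.
case: E => E [lE gE] [E0 phE stE]; split=> //= W K w p q lW w0 T.
apply: tle_unshP => // V gV g.
have lK : tle t K := tle_ext ht (dist_rot T) lE (tle_sh ht lW).
(* [Q] is the cokernel of [w] in the heart, and [I] is its image. *)
have [A [Q [a [b [c [lA gQ T']]]]]] := t_trunc0 ht K.
have lA2 : tle t (sh (sh A)) := tle_sh ht (tle_sh ht lA).
have lQ : tle t Q := tle_ext ht (dist_rot T') lK lA2.
have [I [j [d TI]]] := dist_fiber (b \oc p).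
have gI : tge t I := tge_fiber ht TI gE gQ.
have lI : tle t I.
  apply: tleP => // Y gY; apply/hz_sh.
  have [al [be [TJ _ _ _ _]]] := TR4 (dist_rot T) (dist_rot TI) (dist_rot T').
  by apply: (hz_mid_dist TJ); apply: (hz_sh_tge ht) => //; exact: (tle_sh ht).
suff Q0 : is_zero Q.
  have [|g' ->] := dist_desc1 T' (u := g); first exact: hz_sh_tge lA gV _.
  by rewrite ((Q0 _).1 g') cmp0m.
apply: contrapT => Qn0.
have [w' ew] : exists w', w = j \oc w'.
  by apply: (dist_lift1 TI); rewrite -cmpA (dist_cmp1 T) cmpm0.
pose I' : heart t := exist _ I (conj lI gI).
pose Q' : heart t := exist _ Q (conj lQ gQ).
have nz (X : heart t) : ~ is_zero (sval X) -> ~ is_zero X.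
  by move=> X0 H; apply: X0; apply: is_zero_id; exact: (H X).1.
have I'n0 : ~ is_zero I'.
  apply: nz => I0; apply: w0; rewrite ew ((I0 _).2 w') cmpm0 //.
have [phI hI] := ps_phase I'n0.
have [phQ hQ] := ps_phase (nz Q' Qn0).
have phI1 : phI < 1.
  apply: (stE I' j) hI => //.
  - move=> [X [lX gX]] x y exy; apply/eqP; rewrite -subr_eq0; apply/eqP.
    apply: (dist_mono_tle ht TI gQ lX); rewrite cmpmB.
    by apply/eqP; rewrite subr_eq0; exact/eqP.
  - by move=> ji; apply: Qn0; exact: dist_iso_zero TI ji.
have := has_phase1_Im phE; rewrite /charge /heart_charge /= (K0class_dist TI).
rewrite !raddfD /=; move: (has_phase_Im_gt0 hI phI1) (has_phase_Im_ge0 hQ).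
rewrite /heart_charge /=.
case: (ps_Z sigma _) => ar ai; case: (ps_Z sigma _) => br bi /= ai0 bi0 e.
by move: (ltr_wpDr bi0 ai0); rewrite e ltxx.
Qed.

End StableSimple.

Section SimpleObjects.
Variables (k : fieldType) (D : triCat k) (t : tpair D).
Hypothesis ht : is_tstruct t.
Implicit Types X Y Z W E : D.

Lemma simple_heart_iso E E' :
  isom E E' -> simple_heart t E -> simple_heart t E'.
Proof.
move=> EE' [lE gE sE]; split; [exact: tle_iso EE' lE|exact: tge_iso EE' gE|].
move=> W K w p q lW w0 T; have [e [e' [e'e ee']]] := EE'.
apply: sE lW _ (dist_isom e'e ee' T) => w1; apply: w0.
by rewrite -[w]cmp1m -ee' -cmpA w1 cmpm0.
Qed.

(** A map into the kernel of [x], being nonzero, would have its cone in degrees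
    at most -1 by simplicity; [x] would factor through this cone, and vanish. *)
Lemma simple_cone_tge E X K (x : hom E X) (p : hom X K) (q : hom K (sh E)) :
  simple_heart t E -> tge t X -> x <> 0 -> dist x p q -> tge t K.
Proof.
move=> [lE gE sE] gX x0 T; apply: tgeP => // W lW g.
have [w ew] := shm_full (q \oc g).
have xw : x \oc w = 0.
  by apply: shm_inj; rewrite shm_cmp -ew cmpA (dist_cmp3 T) cmp0m shm0.
have w0 : w = 0.
  apply: contrapT => wn0; have [C [p' [q' T']]] := TR1_cone w.
  have [u eu] := dist_desc1 T' xw; apply: x0; rewrite eu.
  suff -> : u = 0 by rewrite cmp0m.
  suff: hz C X by [].
  have lC := sE _ _ _ _ _ lW wn0 T'.
  exact: hz_isol (unshK C) (hz_sh_tge ht lC gX).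
have [|v ->] := dist_lift2 T (u := g); first by rewrite ew w0 shm0.
by rewrite (hz_sh_tge ht lW gX v) cmpm0.
Qed.

End SimpleObjects.

(** Phases of objects of the heart lie in (0, 1], so phase 1 forces the shift
    to be trivial. *)
Lemma stable_phase1_simple (R : realType) k (D : triCat k) (L : zmodType)
    (v : {additive K0 D -> L}) (sigma : prestab R v) (E : D) :
  stable_of_phase sigma E 1 -> simple_heart (ps_t sigma) E.
Proof.
move=> [A [n [psi [stA EA e]]]].
have [_ [/andP[psi0 psi1] _] _] := stA.
have n0 : n = 0.
  have en : n%:~R = 1 - psi.
    by apply/eqP; rewrite eq_sym subr_eq addrC; exact/eqP.
  have : 0 <= (n%:~R : R) < 1 by rewrite en subr_ge0 psi1 gtrBl.
  by rewrite ler0z ltrz1; case: n {en e EA} => [[|n]|n].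
have psi_1 : psi = 1 by move: e; rewrite n0 addr0.
move: stA EA; rewrite n0 psi_1 => stA EA.
apply: simple_heart_iso (ps_tstruct sigma) _ _ (isom_sym EA) _.
exact: stable_simple.
Qed.

(** * Finite families of generators of a graded vector space *)

Section Spanning.
Variable k : fieldType.
Implicit Types V W : int -> lmodType k.

Definition linear_family V (S : forall n, V n -> Prop) :=
  (forall n, S n 0) /\
  forall n a (x y : V n), S n x -> S n y -> S n (a *: x + y).

Fixpoint family_has V (S : forall n, V n -> Prop) (s : seq {n & V n}) : Prop :=
  if s is x :: s' then S (tag x) (tagged x) /\ family_has S s' else True.

(** Generation is tested against all linear subfamilies containing [s], which
    avoids sums over the entries of a given degree of a list of dependent
    pairs. *)
Definition spans V (s : seq {n & V n}) :=
  forall S : forall n, V n -> Prop, linear_family S -> family_has S s ->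
    forall n x, S n x.

Lemma family_has_cat V (S : forall n, V n -> Prop) s1 s2 :
  family_has S (s1 ++ s2) <-> family_has S s1 /\ family_has S s2.
Proof. by elim: s1 => [|x s1 IH] /=; [split=> // -[]|rewrite IH and_assoc]. Qed.

Lemma fin_total_dim_spans V :
  fin_total_dim V -> exists s : seq {n & V n}, spans s.
Proof.
move=> [fd [N vanish]].
suff [s Hs] : exists s : seq {n & V n}, forall S : forall n, V n -> Prop,
    linear_family S -> family_has S s -> forall n x, (`|n| <= N)%N -> S n x.
  exists s => S lS hS n x; have [nN|Nn] := leqP `|n| N; first exact: Hs.
  by rewrite (vanish n Nn x); exact: lS.1.
have one n : exists s : seq {n & V n}, forall S : forall n, V n -> Prop,
    linear_family S -> family_has S s -> forall x : V n, S n x.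
  have [b bP] := fd n; exists [seq Tagged V x | x <- b] => S lS hS x.
  have hb (i : 'I_(size b)) : S n b`_i.
    case: i => i /= ilt.
    elim: b i ilt hS {bP} => //= y b IH [|i] ilt [Sy Sb] //.
    exact: IH.
  have [c ->] := bP x; apply: big_rec => [|i y _ Sy]; first exact: lS.1.
  exact: lS.2.
suff H m : exists s : seq {n & V n}, forall S : forall n, V n -> Prop,
    linear_family S -> family_has S s -> forall n x, (`|n| < m)%N -> S n x.
  by have [s Hs] := H N.+1; exists s => S lS hS n x nN; exact: Hs.
elim: m => [|m [s Hs]]; first by exists [::].
have [s1 H1] := one m; have [s2 H2] := one (- m%:Z).
exists (s1 ++ s2 ++ s) => S lS /family_has_cat[h1 /family_has_cat[h2 h]] n x.
rewrite ltnS leq_eqVlt => /orP[/eqP nm|]; last exact: Hs.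
have : n = m \/ n = - m%:Z by rewrite -nm; case: n {x nm} => n; [left|right].
by case=> nE; move: x; rewrite nE; [exact: H1|exact: H2].
Qed.

Definition map_family V W (phi : forall n, V n -> W n) (x : {n & V n}) :
  {n & W n} := Tagged W (phi (tag x) (tagged x)).

Lemma spans_map V W (phi : forall n, V n -> W n) s :
  (forall n, linear (phi n)) -> (forall n y, exists x, phi n x = y) ->
  spans s -> spans (map (map_family phi) s).
Proof.
move=> phil phis Hs S [S0 SD] hS n y; have [x <-] := phis n y.
apply: (Hs (fun n x => S n (phi n x))); last first.
  by elim: s hS {Hs} => //= z s IH [Sz /IH].
split=> [m|m a u w Su Sw]; last by rewrite phil; exact: SD.
by have := phil m (-1) 0 0; rewrite !scaler0 addr0 scaleN1r addNr => ->.
Qed.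

Lemma spans_drop0 V n s : spans (Tagged V (0 : V n) :: s) -> spans s.
Proof. by move=> H S lS hS; apply: H => //; split=> //; exact: lS.1. Qed.

Lemma spans_nil V n (x : V n) : spans (V := V) [::] -> x = 0.
Proof.
move=> H; apply: (H (fun n x => x = 0)) => //; split=> // m a y z -> ->.
by rewrite scaler0 addr0.
Qed.

End Spanning.

Section ShiftHom.
Variables (k : fieldType) (D : triCat k).
Implicit Types X Y Z W : D.

(** Finite generation passes along surjections, so the inverses of the
    isomorphisms below need not be recorded. *)
Definition linear_onto (V W : lmodType k) :=
  exists f : V -> W, linear f /\ forall y, exists x, f x = y.

Lemma linear_onto_trans (U V W : lmodType k) :
  linear_onto U V -> linear_onto V W -> linear_onto U W.
Proof.
move=> [f [fl fs]] [g [gl gs]]; exists (g \o f); split.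
  by move=> a x y /=; rewrite fl gl.
by move=> z; have [y <-] := gs z; have [x <-] := fs y; exists x.
Qed.

Lemma linear_onto_sh X Y : linear_onto (hom X (sh Y)) (hom (unsh X) Y).
Proof.
have [s sK Ks] := shm_bij (unsh X) Y; have [e [e' [e'e ee']]] := unshK X.
exists (fun f => s (f \oc e)); split=> [a f g|y].
  by apply: shm_inj; rewrite shm_lin !Ks cmpDm cmpZm.
by exists (shm y \oc e'); rewrite -cmpA e'e cmpm1 sK.
Qed.

Lemma linear_onto_unsh X Y : linear_onto (hom X (unsh Y)) (hom (sh X) Y).
Proof.
have [e [e' [e'e ee']]] := unshK Y.
exists (fun f => e \oc shm f); split=> [a f g|y].
  by rewrite shm_lin cmpmD cmpmZ.
have [x ex] := shm_full (e' \oc y); exists x.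
by rewrite -ex cmpA ee' cmp1m.
Qed.

Lemma linear_onto_shn X Y n :
  linear_onto (hom X (shn n Y)) (hom (shn (- n) X) Y).
Proof.
case: n => n.
  have -> : shn (- n%:Z) X = iter n unsh X by case: n.
  elim: n X => [|n IH] X; first by exists id; split=> // y; exists y.
  apply: linear_onto_trans (linear_onto_sh _ _) _.
  by have := IH (unsh X); rewrite -iterSr.
rewrite NegzE opprK -NegzE /shn.
elim: n.+1 X => [|m IH] X; first by exists id; split=> // y; exists y.
apply: linear_onto_trans (linear_onto_unsh _ _) _.
by have := IH (sh X); rewrite -iterSr.
Qed.

End ShiftHom.

(** * Reflections and coreflections *)

Section Reflections.
Variables (k : fieldType) (D : triCat k) (P : D -> Prop).
Hypothesis PT : triSub P.
Implicit Types X Y Z T : D.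

(** Reflections are described by a triangle, a form that is stable under shifts
    and extensions; [reflects] is the universal property that it yields.  The
    latter also makes sense for [P] the aisle or the coaisle of a
    t-structure. *)
Definition reflection X X' :=
  P X' /\ exists (T : D) (u : hom X X') (g : hom X' T) (h : hom T (sh X)),
    dist u g h /\ forall Y, P Y -> hz T Y.

Definition coreflection X X' :=
  P X' /\ exists (T : D) (u : hom X' X) (g : hom X T) (h : hom T (sh X')),
    dist u g h /\ forall Y, P Y -> hz Y T.

Definition reflects X X' (u : hom X X') :=
  (forall Y (f : hom X Y), P Y -> exists v, f = v \oc u) /\
  (forall Y (v : hom X' Y), P Y -> v \oc u = 0 -> v = 0).

Definition coreflects X X' (u : hom X' X) :=
  (forall Y (f : hom Y X), P Y -> exists v, f = u \oc v) /\
  (forall Y (v : hom Y X'), P Y -> u \oc v = 0 -> v = 0).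

Lemma dist_reflects X X' T (u : hom X X') (g : hom X' T) (h : hom T (sh X)) :
  dist u g h -> (forall Y, P Y -> hz T Y) -> reflects u.
Proof.
move=> T1 HT; split=> [Y f PY|Y v PY vu].
  have [|v ev] := dist_desc3 T1 (u := shm f).
    by have /(_ (shm f \oc h)) := HT _ (ts_sh PT PY).
  have [w ew] := shm_full v; exists w.
  by apply: shm_inj; rewrite shm_cmp -ew.
have [w ->] := dist_desc1 T1 vu.
by rewrite (HT _ PY w) cmp0m.
Qed.

Lemma dist_coreflects X X' T (u : hom X' X) (g : hom X T) (h : hom T (sh X')) :
  dist u g h -> (forall Y, P Y -> hz Y T) -> coreflects u.
Proof.
move=> T1 HT; split=> [Y f PY|Y v PY vu].
  by apply: (dist_lift1 T1); exact: HT.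
apply: shm_inj; rewrite shm0.
have [|w ->] := dist_lift3 T1 (u := shm v); first by rewrite -shm_cmp vu shm0.
by rewrite (HT _ (ts_sh PT PY) w) cmpm0.
Qed.

Lemma reflection_reflects X X' :
  reflection X X' -> exists u : hom X X', reflects u.
Proof.
by move=> [_ [T [u [g [h [T1 HT]]]]]]; exists u; exact: (dist_reflects T1 HT).
Qed.

Lemma coreflection_coreflects X X' :
  coreflection X X' -> exists u : hom X' X, coreflects u.
Proof.
by move=> [_ [T [u [g [h [T1 HT]]]]]]; exists u; exact: (dist_coreflects T1 HT).
Qed.

Lemma reflects_inj X X' (u : hom X X') Y (v w : hom X' Y) :
  reflects u -> P Y -> v \oc u = w \oc u -> v = w.
Proof.
move=> [_ ui] PY e; apply/eqP; rewrite -subr_eq0; apply/eqP.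
by apply: ui => //; rewrite cmpBm e subrr.
Qed.

Lemma coreflects_inj X X' (u : hom X' X) Y (v w : hom Y X') :
  coreflects u -> P Y -> u \oc v = u \oc w -> v = w.
Proof.
move=> [_ ui] PY e; apply/eqP; rewrite -subr_eq0; apply/eqP.
by apply: ui => //; rewrite cmpmB e subrr.
Qed.

Lemma reflection_sh X X' : reflection X X' -> reflection (sh X) (sh X').
Proof.
move=> [PX' [T [u [g [h [T1 HT]]]]]]; split; first exact: ts_sh.
exists (sh T), (- shm u), (- shm g), (- shm h).
split; first exact: (dist_sh _ _ _).1 T1.
move=> Y PY; apply: hz_isor (unshK Y) _; apply/hz_sh.
by apply: HT; exact: ts_unsh.
Qed.

Lemma coreflection_sh X X' : coreflection X X' -> coreflection (sh X) (sh X').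
Proof.
move=> [PX' [T [u [g [h [T1 HT]]]]]]; split; first exact: ts_sh.
exists (sh T), (- shm u), (- shm g), (- shm h).
split; first exact: (dist_sh _ _ _).1 T1.
move=> Y PY; apply: hz_isol (unshK Y) _; apply/hz_sh.
by apply: HT; exact: ts_unsh.
Qed.

Lemma sh_coreflection X X' : coreflection (sh X) (sh X') -> coreflection X X'.
Proof.
move=> [PX' [T [u [g [h [T1 HT]]]]]]; split.
  exact: (ts_iso PT (unsh_sh X') (ts_unsh PT PX')).
have [e [e' [e'e ee']]] := isom_sym (unshK T).
have [u' eu] := shm_fullN u; have [g' eg] := shm_fullN (e \oc g).
have [h' eh] := shm_fullN (h \oc e').
exists (unsh T), u', g', h'; split.
  by apply/dist_sh; rewrite -eu -eg -eh; exact: dist_isor T1.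
move=> Y PY; apply/hz_sh; apply: hz_isor (isom_sym (unshK T)) _.
by apply: HT; exact: ts_sh.
Qed.

Lemma reflection_iso X X' X'' :
  isom X' X'' -> reflection X X' -> reflection X X''.
Proof.
move=> i [PX' [T [u [g [h [T1 HT]]]]]]; split; first exact: (ts_iso PT i PX').
have [e [e' [e'e ee']]] := i.
by exists T, (e \oc u), (g \oc e'), h; split=> //; exact: dist_isom T1.
Qed.

Lemma coreflection_iso X X' X'' :
  isom X' X'' -> coreflection X X' -> coreflection X X''.
Proof.
move=> i [PX' [T [u [g [h [T1 HT]]]]]]; split; first exact: (ts_iso PT i PX').
have [e [e' [e'e ee']]] := isom_sym i.
by exists T, (u \oc e), g, (shm e' \oc h); split=> //; exact: dist_isol T1.
Qed.

Lemma coreflection_unsh X X' :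
  coreflection X X' -> coreflection (unsh X) (unsh X').
Proof.
move=> [PX' [T [u [g [h [T1 HT]]]]]]; apply: sh_coreflection.
have [e [e' [e'e ee']]] := isom_sym (unshK X).
apply: (coreflection_iso (isom_sym (unshK X'))); split=> //.
by exists T, (e \oc u), (g \oc e'), h; split=> //; exact: dist_isom T1.
Qed.

Lemma reflection_id X : P X -> reflection X X.
Proof.
move=> PX; split=> //; have [T [g [h [T0 T1]]]] := dist_id_zero X.
by exists T, (idm X), g, h; split=> // Y _; exact: (T0 Y).1.
Qed.

Lemma coreflection_id X : P X -> coreflection X X.
Proof.
move=> PX; split=> //; have [T [g [h [T0 T1]]]] := dist_id_zero X.
by exists T, (idm X), g, h; split=> // Y _; exact: (T0 Y).2.
Qed.

Lemma reflects_isom X X' X'' (u : hom X X') (w : hom X X'') :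
  P X' -> P X'' -> reflects u -> reflects w -> isom X' X''.
Proof.
move=> P1 P2 ru rw.
have [a ea] := ru.1 _ w P2; have [b eb] := rw.1 _ u P1; exists a, b; split.
  by apply: (reflects_inj ru) => //; rewrite -cmpA -ea -eb cmp1m.
by apply: (reflects_inj rw) => //; rewrite -cmpA -eb -ea cmp1m.
Qed.

Lemma coreflects_isom X X' X'' (u : hom X' X) (w : hom X'' X) :
  P X' -> P X'' -> coreflects u -> coreflects w -> isom X' X''.
Proof.
move=> P1 P2 ru rw.
have [a ea] := ru.1 _ w P2; have [b eb] := rw.1 _ u P1; exists b, a; split.
  by apply: (coreflects_inj ru) => //; rewrite cmpA -ea -eb cmpm1.
by apply: (coreflects_inj rw) => //; rewrite cmpA -eb -ea cmpm1.
Qed.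

Lemma reflection_isom X X' X'' :
  reflection X X' -> reflection X X'' -> isom X' X''.
Proof.
move=> r1 r2; have [u ru] := reflection_reflects r1.
have [w rw] := reflection_reflects r2.
exact: reflects_isom r1.1 r2.1 ru rw.
Qed.

Lemma coreflection_isom X X' X'' :
  coreflection X X' -> coreflection X X'' -> isom X' X''.
Proof.
move=> r1 r2; have [u ru] := coreflection_coreflects r1.
have [w rw] := coreflection_coreflects r2.
exact: coreflects_isom r1.1 r2.1 ru rw.
Qed.

Lemma left_adjoint_reflection (F : functor D (fullsub P)) X (X' : fullsub P) :
  adjoint F (incl P) -> reflection X (sval X') -> isom (F X) X'.
Proof.
move=> [phi [phib nat]] r; have [u ru] := reflection_reflects r.
pose eta : hom X (sval (F X)) := phi X (F X) (idm (F X)).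
have phiE (Y : fullsub P) (b : hom (F X) Y) :
    phi X Y b = @cmp _ D _ _ _ b eta.
  have := nat X X (F X) Y (idm X) b (idm (F X)).
  by rewrite fmap_id !cmpm1 => ->.
apply: (@reflects_isom X _ _ eta u) => //; [exact: svalP|exact: r.1|].
split=> [Y f PY|Y w PY e].
  have [psi _ psiK] := phib X (exist _ Y PY); exists (psi f).
  by rewrite -{1}[f]psiK phiE.
apply: (bij_inj (phib X (exist _ Y PY))).
by rewrite !phiE e cmp0m.
Qed.

Lemma right_adjoint_coreflection (F : functor D (fullsub P)) X
    (X' : fullsub P) :
  adjoint (incl P) F -> coreflection X (sval X') -> isom (F X) X'.
Proof.
move=> [phi [phib nat]] r; have [u ru] := coreflection_coreflects r.
have [psi psiK Kpsi] := phib (F X) X.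
pose eps : hom (sval (F X)) X := psi (idm (F X)).
have phiE (Y : fullsub P) (b : hom Y (F X)) :
    phi Y X (@cmp _ D _ _ _ eps b) = b.
  have := nat (F X) Y X X b (idm X) eps.
  by rewrite fmap_id /= cmp1m Kpsi => ->; rewrite !cmp1m.
apply: (@coreflects_isom X _ _ eps u) => //; [exact: svalP|exact: r.1|].
split=> [Y f PY|Y w PY e].
  exists (phi (exist _ Y PY) X f); apply: (bij_inj (phib (exist _ Y PY) X)).
  by rewrite phiE.
by rewrite -[w](phiE (exist _ Y PY)) e -(phiE (exist _ Y PY) 0) cmpm0.
Qed.

End Reflections.

(** * Killing the maps from, and to, an exceptional object *)

Section ScalarEnd.
Variables (k : fieldType) (D : triCat k).
Implicit Types X Y : D.

Definition scalar_end X := forall b : hom X X, exists a, b = a *: idm X.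

Lemma scalar_end_iso X Y : isom X Y -> scalar_end X -> scalar_end Y.
Proof.
move=> [e [e' [e'e ee']]] sX b; have [a ea] := sX (e' \oc b \oc e).
exists a; rewrite -[b]cmp1m -[_ \oc b]cmpm1 -ee'.
have -> : e \oc e' \oc b \oc (e \oc e') = e \oc (e' \oc b \oc e) \oc e'.
  by rewrite !cmpA.
by rewrite ea cmpmZ cmpm1 cmpZm.
Qed.

Lemma scalar_end_sh X : scalar_end (sh X) <-> scalar_end X.
Proof.
split=> sX b; last first.
  have [c ->] := shm_full b; have [a ->] := sX c.
  by exists a; rewrite shmZ shm_id.
have [a ea] := sX (shm b); exists a.
by apply: shm_inj; rewrite ea shmZ shm_id.
Qed.

Lemma scalar_end_shn X n : scalar_end X -> scalar_end (shn n X).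
Proof.
case: n => n sX; first by elim: n => //= n; exact: (scalar_end_sh _).2.
have us Y : scalar_end Y -> scalar_end (unsh Y).
  move=> sY; apply/scalar_end_sh.
  exact: scalar_end_iso (isom_sym (unshK Y)) sY.
by apply: (us); elim: n => //= n; exact: us.
Qed.

(** Up to an isomorphism, [b] is a scalar. *)
Lemma scalar_end_cancel_l X X' Y (f : hom X Y) (b : hom X' X) :
  scalar_end X -> isom X X' -> f <> 0 -> f \oc b = 0 -> b = 0.
Proof.
move=> sX [i [i' [i'i ii']]] f0 fb; have [a ea] := sX (b \oc i).
have : a *: f = 0 by rewrite -[f]cmpm1 -cmpmZ -ea cmpA fb cmp0m.
move/eqP; rewrite scaler_eq0 => /orP[/eqP a0|/eqP//].
by rewrite -[b]cmpm1 -ii' cmpA ea a0 scale0r cmp0m.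
Qed.

Lemma scalar_end_cancel_r X X' Y (f : hom Y X) (b : hom X X') :
  scalar_end X -> isom X X' -> f <> 0 -> b \oc f = 0 -> b = 0.
Proof.
move=> sX [i [i' [i'i ii']]] f0 fb; have [a ea] := sX (i' \oc b).
have : a *: f = 0 by rewrite -[f]cmp1m -cmpZm -ea -cmpA fb cmpm0.
move/eqP; rewrite scaler_eq0 => /orP[/eqP a0|/eqP//].
by rewrite -[b]cmp1m -ii' -cmpA ea a0 scale0r cmpm0.
Qed.

End ScalarEnd.

Section Exceptional.
Variables (k : fieldType) (D : triCat k) (E : D).
Hypothesis hE : exceptional E.
Implicit Types X Y Z W : D.

Let hzE (m n : int) : m != n -> hz (shn m E) (shn n E).
Proof.
move=> mn; have [_ _ [_ H]] := hE; apply/hz_shn_cancel.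
by apply: H; rewrite subr_eq0 eq_sym.
Qed.

Let scE n : scalar_end (shn n E).
Proof.
apply: scalar_end_shn; have [_ _ [[g _ gK] _]] := hE.
by move=> b; exists (g b); rewrite gK.
Qed.

Let shnN_succ n : isom (sh (shn (- n) E)) (shn (1 - n) E).
Proof. by rewrite addrC; exact: shn_succ. Qed.

Lemma rorth_hz_shn X n : rorth E X -> hz (shn n E) X.
Proof.
move=> EX; apply/(hz_shn_cancel E X n 0); rewrite sub0r; exact: EX.
Qed.

(** A nonzero map [f : E[-n] -> X] is removed from [RHom(E, X)] by passing to
    its cone, and no new maps appear: [RHom(E, E)] is the base field, and its
    generator is not killed by [f]. *)
Lemma cone_hom_onto X X1 n (f : hom (shn (- n) E) X) (u : hom X X1)
    (h : hom X1 (sh (shn (- n) E))) :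
  f <> 0 -> dist f u h ->
  forall m (y : hom (shn (- m) E) X1), exists x, u \oc x = y.
Proof.
move=> f0 T m y.
suff : h \oc y = 0 by move=> /(dist_lift2 T)[x ->]; exists x.
have [mn|mn] := eqVneq (- m) (1 - n); last first.
  apply: hz_isor (isom_sym (shnN_succ n)) _ _; exact: hzE.
have i := shnN_succ n; rewrite -mn in i.
have sE : scalar_end (sh (shn (- n) E)) := (scalar_end_sh _).2 (@scE _).
apply: (scalar_end_cancel_l (f := shm f) sE i).
- by rewrite -(shm0 (shn (- n) E) X) => /shm_inj.
- by rewrite cmpA (dist_cmp3 T) cmp0m.
Qed.

Lemma fiber_hom_onto X X1 n (f : hom X (shn n E)) (u : hom X1 X)
    (h : hom (shn n E) (sh X1)) :
  f <> 0 -> dist u f h ->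
  forall m (y : hom X1 (shn m E)), exists x, x \oc u = y.
Proof.
move=> f0 T m y.
suff : shm y \oc h = 0.
  move=> /(dist_desc3 T)[v ev]; have [x ex] := shm_full v; exists x.
  by apply: shm_inj; rewrite shm_cmp -ex.
have i : isom (sh (shn m E)) (shn (m + 1) E) := shn_succ m E.
have [mn|mn] := eqVneq n (m + 1); last first.
  by apply: hz_isor (isom_sym i) _ _; exact: hzE.
rewrite -mn in i.
apply: (scalar_end_cancel_r (@scE n) (isom_sym i) f0).
by rewrite -cmpA (dist_cmp2 T) cmpm0.
Qed.

Variable t : tpair D.
Hypothesis ht : is_tstruct t.
Hypothesis sE : simple_heart t E.

(** The induction is on the number of generators of [RHom(E, X)], the first of
    which is killed by passing to its cone.  The cone stays in the coaisle; for
    a generator of degree 0 this is where the simplicity of [E] enters. *)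
Lemma rorth_reflection X :
  exists X', reflection (rorth E) X X' /\ (tge t X -> tge t X').
Proof.
have [s0 Hs0] := fin_total_dim_spans (let: And3 H _ _ := hE in H X).
have [phi phiP] : exists phi : forall n, RHom E X n -> hom (shn (- n) E) X,
    forall n, linear (phi n) /\ forall y, exists x, phi n x = y.
  exists (fun n => sval (cid (linear_onto_shn E X n))) => n.
  exact: svalP (cid (linear_onto_shn E X n)).
have := spans_map (fun n => (phiP n).1) (fun n => (phiP n).2) Hs0.
move: (map _ s0) => {phi phiP s0 Hs0} s.
have [d] := ubnP (size s); elim: d X s => // d IH X [|[n f] s] sd Hs.
  exists X; split=> //; apply: reflection_id => n.
  have := hz_shn_cancel E X (- n) 0; rewrite sub0r opprK => -[+ _]; apply.
  by move=> x; exact: spans_nil Hs.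
have [f0|f0] := EM (f = 0).
  by apply: (IH X s) => //; move: Hs; rewrite f0; exact: spans_drop0.
have [X1 [u [h T]]] := TR1_cone f.
have Hs1 := spans_map (fun m => cmp_linr (X := shn (- m) E) u)
  (cone_hom_onto f0 T) Hs.
rewrite /= /map_family /= (dist_cmp1 T) in Hs1.
have [|X' [[PX' [T' [u' [g' [h' [T1 HT]]]]]] gX']] :=
  IH X1 _ _ (spans_drop0 Hs1); first by rewrite size_map.
have [K [p [q TK]]] := TR1_cone (u' \oc u).
exists X'; split.
  split=> //; exists K, (u' \oc u), p, q; split=> // Y PY.
  have [a [b [T2 _ _ _ _]]] := TR4 (dist_rot T) TK T1.
  apply: (hz_mid_dist T2); last exact: HT.
  by apply: hz_isol (isom_sym (shn_succ _ _)) _; exact: rorth_hz_shn.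
move=> gX; apply: gX'; have [lE gE _] := sE.
case: n f f0 h T {Hs Hs1 sd} => [[|n]|n] f f0 h T.
- exact: (simple_cone_tge ht sE gX f0 T).
(* In positive degrees the cone is an extension of two objects of the coaisle,
   and in negative degrees there is no nonzero [f]. *)
- apply: (tge_ext ht (dist_rot T) gX); apply: (tge_sh_unsh ht).
  exact: (tge_iter_unsh ht).
- case: f0; suff: hz (shn (- Negz n) E) X by [].
  by apply: (hz_sh_tge ht (X := shn n E)) => //; exact: tle_shn.
Qed.

Lemma lorth_coreflection X :
  exists X', coreflection (lorth E) X X' /\ (tle t X -> tle t X').
Proof.
have [s Hs] := fin_total_dim_spans (let: And3 _ H _ := hE in H X).
have [d] := ubnP (size s); elim: d X s Hs => // d IH X [|[n f] s] Hs sd.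
  exists X; split=> //; apply: coreflection_id => n f.
  exact: (spans_nil f Hs).
have [f0|f0] := EM (f = 0).
  by apply: (IH X s) => //; move: Hs; rewrite f0; exact: spans_drop0.
have [X1 [u [h T]]] := dist_fiber f.
have Hs1 := spans_map (fun m => cmp_linl (Z := shn m E) u)
  (fiber_hom_onto f0 T) Hs.
rewrite /= /map_family /= (dist_cmp1 T) in Hs1.
have [|X' [[PX' [T' [u' [g' [h' [T1 HT]]]]]] lX']] :=
  IH X1 _ (spans_drop0 Hs1); first by rewrite size_map.
have [K [p [q TK]]] := TR1_cone (u \oc u').
exists X'; split.
  split=> //; exists K, (u \oc u'), p, q; split=> // Y PY.
  have [a [b [T2 _ _ _ _]]] := TR4 T1 TK T.
  by apply: (hz_dist_mid T2); [exact: HT|exact: PY].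
move=> lX; apply: lX'; have [lE gE eE] := sE.
case: n f f0 h T {Hs Hs1 sd} => [[|n]|n] f f0 h T.
- exact: (tle_iso ht (unsh_sh X1) (eE _ _ _ _ _ lX f0 (dist_rot T))).
- apply: tleP => // Y gY; apply/hz_sh.
  by apply: (hz_mid_dist (dist_rot (dist_rot T))); apply: (hz_sh_tge ht) => //;
    exact: tle_shn.
- case: f0; suff: hz X (shn (Negz n) E) by [].
  apply: (hz_tle_tge ht) => //=; apply: (tge_sh_unsh ht).
  exact: (tge_iter_unsh ht).
Qed.

End Exceptional.

(** * Projected t-structures *)

Section SubTriangulated.
Variables (k : fieldType) (D : triCat k) (P : D -> Prop) (PT : triSub P).

Lemma sval_shn n (X : subTri PT) : sval (shn n X) = shn n (sval X).
Proof.
by case: n => n /=; [elim: n => //= n ->|congr unsh; elim: n => //= n ->].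
Qed.

Lemma triSub_shn n X : P (shn n X) -> P X.
Proof.
have shP Y : P (sh Y) -> P Y.
  by move=> PY; exact: (ts_iso PT (unsh_sh Y) (ts_unsh PT PY)).
have unP Y : P (unsh Y) -> P Y.
  by move=> PY; exact: (ts_iso PT (unshK Y) (ts_sh PT PY)).
case: n => n /=; first by elim: n => //= n IH /shP.
by move/unP; elim: n => //= n IH /unP.
Qed.

End SubTriangulated.

Section LeftProjection.
Variables (k : fieldType) (D : triCat k) (P : D -> Prop) (PT : triSub P).
Variables (t : tpair D) (F : functor D (subTri PT)).
Hypothesis ht : is_tstruct t.
Hypothesis adjF : @adjoint k D (fullsub P) F (incl P).
Hypothesis refl :
  forall X, exists X', reflection P X X' /\ (tge t X -> tge t X').
Let tB : tpair (subTri PT) := timage F t.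
Implicit Types Y : subTri PT.

Lemma ess_image_reflection (S : D -> Prop) Y :
  ess_image F S Y <-> exists X, S X /\ reflection P X (sval Y).
Proof.
split=> -[X [SX i]]; exists X; split=> //.
  have [X' [r _]] := refl X.
  have i' := left_adjoint_reflection PT (X' := exist _ X' r.1) adjF r.
  exact: (reflection_iso PT (isom_trans (isom_sym i') i) r).
exact: (left_adjoint_reflection PT adjF i).
Qed.

Lemma reflection_tge X X' : reflection P X X' -> tge t X -> tge t X'.
Proof.
move=> r gX; have [X'' [r' /(_ gX)]] := refl X.
exact/(tge_iso ht)/(reflection_isom PT r' r).
Qed.

Lemma left_tle Y : tle tB Y <-> exists X, tle t X /\ reflection P X (sval Y).
Proof. exact: ess_image_reflection. Qed.

Lemma left_tge Y : tge tB Y <-> tge t (sval Y).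
Proof.
rewrite /tB /= ess_image_reflection; split=> [[X [gX r]]|gY].
  exact: reflection_tge r gX.
by exists (sval Y); split=> //; apply: reflection_id; exact: svalP.
Qed.

Lemma left_hz X (Y : D) (Z : D) :
  tle t X -> reflection P X Y -> P Z -> tge t (sh Z) -> hz Y Z.
Proof.
move=> lX r PZ gZ; have [u [_ ui]] := reflection_reflects PT r.
by move=> f; apply: ui => //; exact: hz_tle_tge lX gZ _.
Qed.

(** The truncation triangle in the subcategory is the reflection of the
    truncation triangle in the ambient category. *)
Lemma left_projection_tstruct : is_tstruct tB.
Proof.
split.
- by move=> X Y XY [A [lA i]]; exists A; split=> //; exact: isom_trans i XY.
- by move=> X Y XY [A [lA i]]; exists A; split=> //; exact: isom_trans i XY.
- move=> Y /left_tle[X [lX r]]; apply/left_tle; exists (sh X); split.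
    exact: (tle_sh ht).
  exact: (reflection_sh PT r).
- by move=> Y /left_tge gY; apply/left_tge; exact: (tge_unsh ht).
- move=> X Y /left_tle[A [lA r]] /left_tge gY.
  apply: (left_hz lA r (ts_unsh PT (svalP Y))); exact: tge_sh_unsh.
- move=> [X PX].
  have [A [B [f [g [h [lA gB T]]]]]] := t_trunc1 ht X.
  have [A' [r _]] := refl A.
  have [PA' [Ta [a [b [c [Ta1 HT]]]]]] := r.
  have [ae _] := dist_reflects PT Ta1 HT.
  have [f' ef] := ae _ f PX; rewrite {}ef in T.
  have [C [p [q T']]] := TR1_cone f'.
  have [b1 [b2 [T2 _ _ _ _]]] := TR4 Ta1 T T'.
  have PC : P C := ts_cone PT T' PA' PX.
  have rC : reflection P B C.
    split=> //; exists (sh Ta), b2, (shm b \oc q), (- shm b1).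
    split; first exact: dist_rot T2.
    move=> Y PY; apply: hz_isor (unshK Y) _; apply/hz_sh; apply: HT.
    exact: ts_unsh.
  have gC : tge t (sh C) by exact: reflection_tge (reflection_sh PT rC) gB.
  have [e [e' [e'e ee']]] := isom_sym (unsh_sh C).
  exists (exist _ A' PA'), (exist _ (sh C) (ts_sh PT PC)), f', (e \oc p).
  exists (q \oc e'); split.
  + by apply/left_tle; exists A.
  + exact/left_tge.
  + exact: (dist_isor ee' e'e T').
Qed.

Lemma left_projection_bounded : tbounded t -> tbounded tB.
Proof.
move=> bt Y; have [a [b [[X [gX iX]] [Z [lZ iZ]]]]] := bt (sval Y).
have PX : P X.
  exact: (triSub_shn PT (ts_iso PT (isom_sym iX) (svalP Y))).
have PZ : P Z.
  exact: (triSub_shn PT (ts_iso PT (isom_sym iZ) (svalP Y))).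
exists a, b; split; [exists (exist _ X PX)|exists (exist _ Z PZ)]; split.
- exact/left_tge.
- by have := iX; rewrite -(sval_shn _ (exist _ X PX)).
- by apply/left_tle; exists Z; split=> //; exact: reflection_id.
- by have := iZ; rewrite -(sval_shn _ (exist _ Z PZ)).
Qed.

End LeftProjection.

Section RightProjection.
Variables (k : fieldType) (D : triCat k) (P : D -> Prop) (PT : triSub P).
Variables (t : tpair D) (F : functor D (subTri PT)).
Hypothesis ht : is_tstruct t.
Hypothesis adjF : @adjoint k (fullsub P) D (incl P) F.
Hypothesis corefl :
  forall X, exists X', coreflection P X X' /\ (tle t X -> tle t X').
Let tC : tpair (subTri PT) := timage F t.
Implicit Types Y : subTri PT.

Lemma ess_image_coreflection (S : D -> Prop) Y :
  ess_image F S Y <-> exists X, S X /\ coreflection P X (sval Y).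
Proof.
split=> -[X [SX i]]; exists X; split=> //.
  have [X' [r _]] := corefl X.
  have i' := right_adjoint_coreflection PT (X' := exist _ X' r.1) adjF r.
  exact: (coreflection_iso PT (isom_trans (isom_sym i') i) r).
exact: (right_adjoint_coreflection PT adjF i).
Qed.

Lemma coreflection_tle X X' : coreflection P X X' -> tle t X -> tle t X'.
Proof.
move=> r lX; have [X'' [r' /(_ lX)]] := corefl X.
exact/(tle_iso ht)/(coreflection_isom PT r' r).
Qed.

Lemma right_tge Y : tge tC Y <-> exists X, tge t X /\ coreflection P X (sval Y).
Proof. exact: ess_image_coreflection. Qed.

Lemma right_tle Y : tle tC Y <-> tle t (sval Y).
Proof.
rewrite /tC /= ess_image_coreflection; split=> [[X [gX r]]|gY].
  exact: coreflection_tle r gX.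
by exists (sval Y); split=> //; apply: coreflection_id; exact: svalP.
Qed.

Lemma right_hz X (Y : D) (Z : D) :
  tge t X -> coreflection P X Y -> P Z -> tle t Z -> hz (sh Z) Y.
Proof.
move=> gX r PZ lZ; have [u [_ ui]] := coreflection_coreflects PT r.
by move=> f; apply: ui; [exact: ts_sh|exact: (hz_sh_tge ht lZ gX)].
Qed.

Lemma right_projection_tstruct : is_tstruct tC.
Proof.
split.
- by move=> X Y XY [A [lA i]]; exists A; split=> //; exact: isom_trans i XY.
- by move=> X Y XY [A [lA i]]; exists A; split=> //; exact: isom_trans i XY.
- by move=> Y /right_tle gY; apply/right_tle; exact: (tle_sh ht).
- move=> Y /right_tge[X [gX r]]; apply/right_tge; exists (unsh X); split.
    exact: (tge_unsh ht).
  exact: (coreflection_unsh PT r).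
- move=> X Y /right_tle lX /right_tge[A [gA r]] f.
  apply: shm_inj; rewrite shm0.
  have H := right_hz gA r (svalP X) lX.
  exact: (hz_isor (isom_sym (unshK (sval Y))) H).
- move=> [X PX].
  have [A [B [f [g [h [lA gB T]]]]]] := t_trunc1 ht X.
  have [B' [r _]] := corefl B.
  have [PB' [Tb [a [b [c [Tb1 HT]]]]]] := r.
  have [ae _] := dist_coreflects PT Tb1 HT.
  have [g' eg] := ae _ g PX; rewrite {}eg in T.
  have [A' [p [q T']]] := dist_fiber g'.
  have PsA : P (sh A') := ts_cone PT (dist_rot T') PX PB'.
  have PA : P A' := ts_iso PT (unsh_sh A') (ts_unsh PT PsA).
  have [b1 [b2 [T2 _ _ _ _]]] := TR4 (dist_rot T') (dist_rot T) Tb1.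
  have rA : coreflection P A A'.
    apply: (sh_coreflection PT); split=> //.
    by exists Tb, b1, b2, (shm q \oc c); split.
  have lA' : tle t A' := coreflection_tle rA lA.
  have [e [e' [e'e ee']]] := isom_sym (unsh_sh B').
  exists (exist _ A' PA), (exist _ (sh B') (ts_sh PT PB')), p, (e \oc g').
  exists (q \oc e'); split.
  + exact/right_tle.
  + apply/right_tge; exists (sh B); split=> //; exact: (coreflection_sh PT r).
  + exact: (dist_isor ee' e'e T').
Qed.

Lemma right_projection_bounded : tbounded t -> tbounded tC.
Proof.
move=> bt Y; have [a [b [[X [gX iX]] [Z [lZ iZ]]]]] := bt (sval Y).
have PX : P X.
  exact: (triSub_shn PT (ts_iso PT (isom_sym iX) (svalP Y))).
have PZ : P Z.
  exact: (triSub_shn PT (ts_iso PT (isom_sym iZ) (svalP Y))).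
exists a, b; split; [exists (exist _ X PX)|exists (exist _ Z PZ)]; split.
- by apply/right_tge; exists X; split=> //; exact: coreflection_id.
- by have := iX; rewrite -(sval_shn _ (exist _ X PX)).
- exact/right_tle.
- by have := iZ; rewrite -(sval_shn _ (exist _ Z PZ)).
Qed.

End RightProjection.

(** * Chains of subobjects in the projected hearts *)

(** The assignment on subobjects is given by a relation, as it does not always
    come from a functor that preserves monomorphisms. *)
Definition subobjects_embed k (C1 C2 : linCat k) :=
  forall A : C1, exists (B : C2)
      (R : forall (Y : C1) (J : C2), hom Y A -> hom J B -> Prop),
    (forall (Y : C1) (i : hom Y A), mono i ->
       exists (J : C2) (j : hom J B), mono j /\ R Y J i j) /\
    (forall (Y Y' : C1) (J J' : C2) (i : hom Y A) (i' : hom Y' A)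
        (j : hom J B) (j' : hom J' B),
       R Y J i j -> R Y' J' i' j' -> (sub_le i i' <-> sub_le j j')).

Section Embedding.
Variables (k : fieldType) (C1 C2 : linCat k).
Hypothesis emb : subobjects_embed C1 C2.

Lemma subobjects_embed_chain (A : C1) (F : nat -> C1)
    (i : forall n, hom (F n) A) :
  (forall n, mono (i n)) ->
  exists (B : C2) (G : nat -> C2) (j : forall n, hom (G n) B),
    (forall n, mono (j n)) /\
    forall m n, sub_le (i m) (i n) <-> sub_le (j m) (j n).
Proof.
move=> mi; have [B [R [Rex Rle]]] := emb A.
have /choice[G HG] n : exists x : {J : C2 & hom J B},
    mono (tagged x) /\ R _ _ (i n) (tagged x).
  by have [J [j Hj]] := Rex _ _ (mi n); exists (existT _ J j).
exists B, (fun n => tag (G n)), (fun n => tagged (G n)); split=> [n|m n].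
  exact: (HG n).1.
exact: Rle (HG m).2 (HG n).2.
Qed.

Lemma noetherian_embed : noetherian C2 -> noetherian C1.
Proof.
move=> nC A F i mi ile; have [B [G [j [mj le]]]] := subobjects_embed_chain mi.
have [|N HN] := nC B G j mj; first by move=> n; apply/le.
by exists N => n /HN[h1 h2]; split; apply/le.
Qed.

Lemma artinian_embed : artinian C2 -> artinian C1.
Proof.
move=> nC A F i mi ile; have [B [G [j [mj le]]]] := subobjects_embed_chain mi.
have [|N HN] := nC B G j mj; first by move=> n; apply/le.
by exists N => n /HN[h1 h2]; split; apply/le.
Qed.

End Embedding.

Section LeftHeart.
Variables (k : fieldType) (D : triCat k) (P : D -> Prop) (PT : triSub P).
Variables (t : tpair D) (F : functor D (subTri PT)).
Hypothesis ht : is_tstruct t.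
Hypothesis adjF : @adjoint k D (fullsub P) F (incl P).
Hypothesis refl :
  forall X, exists X', reflection P X X' /\ (tge t X -> tge t X').
Let tB : tpair (subTri PT) := timage F t.

(** The cover is the truncation of [Y] in degrees at most 0.  It is also a
    reflection: the vertex [B] of the truncation triangle reflects to the part
    of [Y] in positive degrees for the projected t-structure, which is zero. *)
Lemma left_heart_cover (Y : heart tB) :
  exists (J : heart t) (e : hom (sval J) (sval (sval Y))),
    coreflects (tle t) e /\ reflects P e.
Proof.
case: Y => [[Y PY] [/(left_tle adjF refl)[X [lX r]]
  /(left_tge ht adjF refl) /= gY]] /=.
have [A [B [e [g [h [lA gB T]]]]]] := t_trunc1 ht Y.
have gA : tge t A.
  apply: (tgeP ht) => W lW w; apply: shm_inj; rewrite shm0.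
  have [|v ->] := dist_lift3 T (u := shm w).
    by rewrite -shm_cmp (hz_sh_tge ht lW gY (e \oc w)) shm0.
  by rewrite (hz_tle_tge ht (tle_sh ht (tle_sh ht lW)) gB v) cmpm0.
exists (exist _ A (conj lA gA)), e; split.
  split=> [W w lW|W w lW ew].
    by apply: (dist_lift1 T); exact: (hz_tle_tge ht lW gB).
  apply: shm_inj; rewrite shm0.
  have [|v ->] := dist_lift3 T (u := shm w); first by rewrite -shm_cmp ew shm0.
  by rewrite (hz_tle_tge ht (tle_sh ht lW) gB v) cmpm0.
have [B' [rB _]] := refl B.
have [u [ue ui]] := reflection_reflects PT rB.
have gB' := reflection_tge PT ht refl (reflection_sh PT rB) gB.
apply: (dist_reflects PT T) => V PV f.
have [v ->] := ue _ f PV; have -> : u = 0; last by rewrite cmpm0.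
have [|w ->] := dist_desc2 T (u := u).
  exact: (left_hz PT ht lX r rB.1 gB').
by rewrite (hz_tle_tge ht (tle_sh ht lA) gB' w) cmp0m.
Qed.

(** Truncation in degrees at most 0 is fully faithful on the heart of the
    projected t-structure, and preserves monomorphisms as it is right adjoint
    to reflection. *)
Lemma left_heart_embed : subobjects_embed (heart tB) (heart t).
Proof.
move=> A; have [B [eA [cA rA]]] := left_heart_cover A.
exists B, (fun Y J i j => exists e : hom (sval J) (sval (sval Y)),
  [/\ coreflects (tle t) e, reflects P e
    & @cmp _ D _ _ _ eA j = @cmp _ D _ _ _ i e]).
split=> [Y i mi|Y Y' J J' i i' j j' [e [ce re ej]] [e' [ce' re' ej']]].
  have [J [e [ce re]]] := left_heart_cover Y.
  have [j ej] := cA.1 _ (@cmp _ D _ _ _ i e) (svalP J).1.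
  exists J, j; split; last by exists e.
  move=> W g h gh.
  have [W' [r gW']] := refl (sval W).
  have [u [ue ui]] := reflection_reflects PT r.
  pose W1 : subTri PT := exist _ W' r.1.
  have HW1 : tle tB W1 /\ tge tB W1.
    split; first by apply/(left_tle adjF refl); exists (sval W);
      split=> //; exact: (svalP W).1.
    by apply/(left_tge ht adjF refl); apply: gW'; exact: (svalP W).2.
  pose W2 : heart tB := exist _ W1 HW1.
  have [x ex] := ue _ (@cmp _ D _ _ _ e g) (svalP (sval Y)).
  have [y ey] := ue _ (@cmp _ D _ _ _ e h) (svalP (sval Y)).
  have xy : x = y.
    apply: (mi W2 x y).
    apply: (reflects_inj (conj ue ui) (svalP (sval A))).
    rewrite -[LHS](@cmpA _ D) -[RHS](@cmpA _ D) -ex -ey !cmpA ej -!cmpA.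
    by congr (_ \oc _); exact: gh.
  by apply: (coreflects_inj ce (svalP W).1); rewrite ex ey xy.
split=> [[u eu]|[w ew]].
  have {}eu : i = @cmp _ D _ _ _ i' u := eu.
  have [w ew] := ce'.1 _ (@cmp _ D _ _ _ u e) (svalP J).1.
  exists w; apply: (coreflects_inj cA (svalP J).1).
  by rewrite [RHS](@cmpA _ D) ej ej' eu -!cmpA ew.
have {}ew : j = @cmp _ D _ _ _ j' w := ew.
have [u eu] := re.1 _ (@cmp _ D _ _ _ e' w) (svalP (sval Y')).
exists u; apply: (reflects_inj re (svalP (sval A))).
by rewrite -[RHS](@cmpA _ D) -eu -ej ew !cmpA ej'.
Qed.

End LeftHeart.

Section RightHeart.
Variables (k : fieldType) (D : triCat k) (P : D -> Prop) (PT : triSub P).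
Variables (t : tpair D) (F : functor D (subTri PT)).
Hypothesis ht : is_tstruct t.
Hypothesis adjF : @adjoint k (fullsub P) D (incl P) F.
Hypothesis corefl :
  forall X, exists X', coreflection P X X' /\ (tle t X -> tle t X').
Let tC : tpair (subTri PT) := timage F t.

(** The cover is the truncation of [Y] in degrees at least 0; the coreflection
    of the remaining part vanishes because it lies in negative degrees. *)
Lemma right_heart_cover (Y : heart tC) :
  exists (Q : heart t) (p : hom (sval (sval Y)) (sval Q)),
    reflects (tge t) p /\ coreflects P p.
Proof.
case: Y => [[Y PY] [/(right_tle ht adjF corefl) /= lY
  /(right_tge adjF corefl)[X [gX r]]]] /=.
have [A [B [a [p [c [lA gB T]]]]]] := t_trunc0 ht Y.
have lA2 := tle_sh ht (tle_sh ht lA).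
have lB : tle t B := tle_ext ht (dist_rot T) lY lA2.
exists (exist _ B (conj lB gB)), p; split.
  split=> [W w gW|W w gW wp].
    by apply: (dist_desc1 T); exact: (hz_sh_tge ht lA gW).
  have [v ->] := dist_desc2 T wp.
  by rewrite (hz_sh_tge ht (tle_sh ht lA) gW v) cmp0m.
have [A' [rA /(_ lA) lA']] := corefl A.
have [u [ue ui]] := coreflection_coreflects PT (coreflection_sh PT rA).
have u0 : u = 0.
  apply: shm_inj; rewrite shm0.
  have [|w ->] := dist_lift3 T (u := shm u).
    by rewrite -shm_cmp (right_hz PT ht gX r rA.1 lA' (a \oc u)) shm0.
  by rewrite (hz_sh_tge ht (tle_sh ht lA') gB w) cmpm0.
apply: (dist_coreflects PT (dist_rot T)) => V PV.
apply: hz_isol (unshK V) _; apply/hz_sh => f.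
by have [v ->] := ue _ f (ts_unsh PT PV); rewrite u0 cmp0m.
Qed.

(** A subobject [i : Y -> A] with quotient [Q] is sent to the kernel [J] of
    the map induced from [A] to [Q] on truncations in degrees at least 0,
    which is an epimorphism.  Both [Y] and [J] are determined by the quotient,
    hence so is the order on such subobjects. *)
Lemma right_heart_embed : subobjects_embed (heart tC) (heart t).
Proof.
have htC : is_tstruct tC := right_projection_tstruct ht adjF corefl.
move=> A; have [B [pA [rA cA]]] := right_heart_cover A.
exists B, (fun Y J i j => exists (Q : heart tC) (q : hom A Q) (S : heart t)
    (pQ : hom (sval (sval Q)) (sval S)) (s : hom B S),
  [/\ q \oc i = 0,
      (forall (Z : heart tC) (f : hom Z A), q \oc f = 0 -> sub_le f i)
    & forall (Z : heart tC) (f : hom A Z), f \oc i = 0 ->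
        exists r, f = r \oc q] /\
  [/\ coreflects P pQ, reflects (tge t) pQ,
      @cmp _ D _ _ _ s pA = @cmp _ D _ _ _ pQ q,
      @cmp _ D _ _ _ s j = 0
    & forall (W : D) (f : hom W (sval B)),
        @cmp _ D _ _ _ s f = 0 -> exists w, f = @cmp _ D _ _ _ j w]).
split=> [Y i mi|Y Y' J J' i i' j j'
    [Q [q [S [pQ [s [[qi kq qe] [cQ rQ es sj ks]]]]]]]
    [Q' [q' [S' [pQ' [s' [[qi' kq' qe'] [cQ' rQ' es' sj' ks']]]]]]]].
  have [K [q [d T]]] := @TR1_cone k (subTri PT) _ _ i.
  pose Q : heart tC := exist _ K (heart_mono_cone htC mi T).
  have [S [pQ [rQ cQ]]] := right_heart_cover Q.
  have [s es] := rA.1 _ (@cmp _ D _ _ _ pQ q) (svalP S).2.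
  have [J [j [h TJ]]] := @dist_fiber k D _ _ s.
  have gJ : tge t J := tge_fiber ht TJ (svalP B).2 (svalP S).2.
  have lJ : tle t J.
    apply: (tleP ht) => V gV; apply/hz_sh => g.
    (* The truncation of the epimorphism [q] is an epimorphism: a map out of
       its target that kills it factors through [sh Y]. *)
    have gh : g \oc h = 0.
      apply: rQ.2; first exact: gV.
      have lY : tle t (sval (sval Y)).
        exact: (right_tle ht adjF corefl _).1 (svalP Y).1.
      have [|v ->] := @dist_desc2 _ D _ _ _ _ _ _ T _ (g \oc h \oc pQ).
        rewrite -[LHS](@cmpA _ D) es (cmpA (g \oc h)) -(cmpA g).
        by rewrite (dist_cmp2 TJ) cmpm0 cmp0m.
      by rewrite [v](hz_sh_tge ht lY gV) cmp0m.
    have [v ->] := dist_desc3 TJ gh.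
    by rewrite (hz_sh_tge ht (svalP B).1 gV v) cmp0m.
  exists (exist _ J (conj lJ gJ)), j; split.
    move=> W g g' e; apply/eqP; rewrite -subr_eq0; apply/eqP.
    apply: (dist_mono_tle ht TJ (svalP S).2 (svalP W).1).
    rewrite (@cmpmB _ D).
    by have -> : @cmp _ D _ _ _ j g = @cmp _ D _ _ _ j g' := e; rewrite subrr.
  exists Q, q, S, pQ, s; split; split=> //.
  - exact: dist_cmp1 T.
  - by move=> Z f qf; exact: (dist_lift1 T qf).
  - by move=> Z f fi; exact: (dist_desc1 T fi).
  - exact: dist_cmp1 TJ.
  - by move=> W f sf; exact: (dist_lift1 TJ sf).
split=> [[u eu]|[w ew]].
  have [r er] : exists r, q' = r \oc q.
    by apply: qe; rewrite eu cmpA qi' cmp0m.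
  have [r1 er1] := rQ.1 _ (@cmp _ D _ _ _ pQ' r) (svalP S').2.
  have es1 : s' = @cmp _ D _ _ _ r1 s.
    apply: (reflects_inj rA (svalP S').2).
    rewrite es' -[RHS]cmpA es [RHS]cmpA -er1 -[RHS]cmpA.
    by congr (_ \oc _).
  by apply: ks'; rewrite es1 -cmpA sj cmpm0.
apply: kq'.
have ew' : j = @cmp _ D _ _ _ j' w := ew.
have [x ex] : exists x, @cmp _ D _ _ _ pA i = @cmp _ D _ _ _ j x.
  apply: ks; rewrite cmpA es -cmpA.
  by have -> : @cmp _ D _ _ _ q i = 0 := qi; rewrite cmpm0.
apply: cQ'.2; first exact: (svalP (sval Y)).
by rewrite cmpA -es' -cmpA ex ew' !cmpA sj' !cmp0m.
Qed.

End RightHeart.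

(** * The projected t-structures of a stable exceptional object *)

Theorem proposition4p11 (R : realType) (k : fieldType) (D : triCat k)
    (L : zmodType) (hL : free_of_finite_rank L) (v : {additive K0 D -> L})
    (sigma : prestab R v) (E : D)
    (hE : exceptional E) (hst : stable_of_phase sigma E 1)
    (hB : semiorthogonal (rorth E) (generated E))
    (hC : semiorthogonal (generated E) (lorth E))
    (betaL : functor D (rorthCat E)) (hbeta : adjoint betaL (incl (rorth E)))
    (gammaR : functor D (lorthCat E))
    (hgamma : adjoint (incl (lorth E)) gammaR) :
  let tau := ps_t sigma in
  [/\ is_tstruct (timage betaL tau) /\ tbounded (timage betaL tau),
      is_tstruct (timage gammaR tau) /\ tbounded (timage gammaR tau),
      tnoetherian tau ->
        tnoetherian (timage betaL tau) /\ tnoetherian (timage gammaR tau)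
    & tartinian tau ->
        tartinian (timage betaL tau) /\ tartinian (timage gammaR tau)].
Proof.
move=> tau; have ht : is_tstruct tau := ps_tstruct sigma.
have sE := stable_phase1_simple hst.
have refl := rorth_reflection hE ht sE.
have corefl := lorth_coreflection hE ht sE.
have embB := left_heart_embed ht hbeta refl.
have embC := right_heart_embed ht hgamma corefl.
split.
- split; first exact: (left_projection_tstruct ht hbeta refl).
  exact: (left_projection_bounded ht hbeta refl (ps_bounded sigma)).
- split; first exact: (right_projection_tstruct ht hgamma corefl).
  exact: (right_projection_bounded ht hgamma corefl (ps_bounded sigma)).
- move=> N; split; first exact: noetherian_embed embB N.
  exact: noetherian_embed embC N.
- move=> N; split; first exact: artinian_embed embB N.
  exact: artinian_embed embC N.
Qed.
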